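(* Let $D$ be a two-dimensional regular local ring with fixed regular system of parameters $x,y$, let $0<a<b$ be real numbers, and let $I=[a,b]$ with its usual real topology. Let $X$ be the set of all valuation overrings of the interval ring $T_I$ other than the quotient field $K$, and let $\sim$ be the equivalence relation on $X$ given by $V\sim W$ if $V$ and $W$ have the same rank $1$ valuation overring. Let $\phi:X\to I$ be the map sending $W\in X$ to the $r\in I$ such that $V_r$ is the rank $1$ overring of $W$. Then the induced map $\tilde\phi: X/{\sim}\to I$ is a homeomorphism when $X$ has the patch topology and $X/{\sim}$ the quotient topology, and it is also a homeomorphism when $X$ has the Zariski topology and $X/{\sim}$ the corresponding quotient topology.
   Context: $D$ is a two-dimensional regular local ring with maximal ideal $\mathfrak m=(x,y)$ and quotient field $K$. An overring of a domain is a ring between it and its quotient field. Every nonzero element of $D$ can be written as $u_1\tau_1+\cdots+u_n\tau_n$ with $u_i$ units of $D$ and $\tau_i$ distinct monomials $x^py^q$ ($p,q\ge 0$ integers), none of which divides another in $D$; the set of monomials $\tau_i$ is uniquely determined by the element (and $x,y$). For real $r>0$, the monomial valuation $v_r$ on $K$ is defined by $v_r(0)=\infty$, $v_r(x^py^q)=p+qr$, $v_r(u_1\tau_1+\cdots+u_n\tau_n)=\min_i v_r(\tau_i)$ for such a representation, and $v_r(f/g)=v_r(f)-v_r(g)$ for $f,g\in D$, $g\neq 0$. Its valuation ring is $V_r=\{f\in K: v_r(f)\ge 0\}$. For $I=[a,b]$ the interval ring $T_I$ is the intersection of all valuation rings $V$ such that $D\subseteq V\subseteq V_r$ for some $r\in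 I$. The rank $1$ valuation overrings of $T_I$ are exactly the rings $V_r$, $r\in I$ (distinct for distinct $r$), and each element of $X$ is contained in exactly one of them. Topologies on $X$: the Zariski topology has as a basis of open sets the sets $\{V\in X: F\subseteq V\}$ with $F\subseteq K$ finite; the patch topology has as a basis of open sets the sets $\{V\in X: F\subseteq V,\ G\subseteq \mathfrak m_V\}$ with $F,G\subseteq K$ finite, where $\mathfrak m_V$ is the maximal ideal of $V$. *)

(* Defs.v *)
From HB Require Import structures.
From mathcomp Require Import all_boot all_order all_algebra.
From mathcomp Require Import fraction generic_quotient.
From mathcomp Require Import all_classical all_reals all_analysis.
Set Implicit Arguments.
Unset Strict Implicit.
Unset Printing Implicit Defensive.
Import Order.TTheory GRing.Theory Num.Theory numFieldNormedType.Exports.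
Local Open Scope classical_set_scope.
Local Open Scope ring_scope.
Local Open Scope quotient_scope.

(* Ideals are taken relative to a subring A, given as a set, of an ambient ring
   S, so that the same notions apply to D (A = setT) and to overrings of D
   inside the field of fractions. *)
Section Ideals.
Context {S : comNzRingType}.
Implicit Types (A J P M : set S) (s : seq S).

Definition ideal A J : Prop :=
  [/\ J `<=` A, J 0, forall u v, J u -> J v -> J (u + v)
    & forall c u, A c -> J u -> J (c * u)].

Definition prime_ideal A P : Prop :=
  [/\ ideal A P, ~ P 1
    & forall u v, A u -> A v -> P (u * v) -> P u \/ P v].

Definition maximal_ideal A M : Prop :=
  [/\ ideal A M, ~ M 1
    & forall J, ideal A J -> ~ J 1 -> M `<=` J -> J = M].

Definition prime_chain A (n : nat) : Prop :=
  exists P : 'I_n.+1 -> set S,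
    (forall i, prime_ideal A (P i)) /\
    (forall i j : 'I_n.+1, (i < j)%N -> P i `<` P j).

Definition krull_dim A (n : nat) : Prop :=
  prime_chain A n /\ forall m, prime_chain A m -> (m <= n)%N.

Definition ideal_span s : set S :=
  [set \sum_(i < size s) c i * s`_i | c in [set: 'I_(size s) -> S]].

End Ideals.

Definition noetherian (S : comNzRingType) : Prop :=
  forall J : set S, ideal setT J -> exists s : seq S, J = ideal_span s.

(* S is a regular local ring, of dimension size s, and s is a regular system of
   parameters of S. *)
Definition regular_local_ring_with (S : comNzRingType) (s : seq S) : Prop :=
  [/\ noetherian S,
      forall M : set S, maximal_ideal setT M <-> M = ideal_span s
    & krull_dim [set: S] (size s)].

Section ValuationRings.
Context {K : fieldType}.
Implicit Types (U V W : set K).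

Definition valuation_ring V : Prop :=
  GRing.subring_closed [in V] /\ forall z, V z \/ V z^-1.

(* The maximal ideal of a valuation ring V is its set of nonunits. *)
Definition nonunits V : set K :=
  [set z | V z /\ ~ (z != 0 /\ V z^-1)].

Definition rank1_overrings W : set (set K) :=
  [set U | [/\ valuation_ring U, W `<=` U & krull_dim U 1]].

End ValuationRings.

Section MonomialValuations.
Context {R : realType} {D : idomainType} (x y : D).
Local Notation K := {fraction D}.
Local Notation "f %:F" := (@FracField.tofrac D f).
Implicit Types (r : R) (f : D) (z : K).

Definition monomial (e : nat * nat) : D := x ^+ e.1 * y ^+ e.2.

Definition divides (u v : D) : Prop := exists c, v = c * u.

(* The non-divisibility condition also makes the monomials distinct. *)
Definition monomial_rep n (u : 'I_n -> D) (e : 'I_n -> nat * nat) f : Prop :=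
  [/\ f = \sum_(i < n) u i * monomial (e i),
      forall i, u i \is a GRing.unit
    & forall i j, i != j -> ~ divides (monomial (e i)) (monomial (e j))].

Definition monomial_value r (e : nat * nat) : \bar R :=
  (e.1%:R + e.2%:R * r)%:E.

(* When (x, y) is a regular system of parameters, the value selected by xget
   exists and does not depend on the representation; likewise in mval. *)
Definition mval_dom r f : \bar R :=
  if f == 0 then +oo%E else
  xget +oo%E [set v | exists n (u : 'I_n -> D) (e : 'I_n -> nat * nat),
    monomial_rep u e f /\ v = \big[mine/+oo%E]_(i < n) monomial_value r (e i)].

Definition mval r z : \bar R :=
  xget +oo%E [set v | exists f g : D,
    [/\ g != 0, z = f%:F / g%:F & v = (mval_dom r f - mval_dom r g)%E]].

Definition mval_ring r : set K := [set z | (0 <= mval r z)%E].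

Definition interval_ring (a b : R) : set K :=
  [set z | forall V : set K, valuation_ring V -> (forall f : D, V f%:F) ->
     (exists2 r, r \in `[a, b] & V `<=` mval_ring r) -> V z].

Definition val_overrings (a b : R) : set (set K) :=
  [set W | [/\ valuation_ring W, interval_ring a b `<=` W & W <> setT]].

End MonomialValuations.

Section Space.
Context {R : realType} {D : idomainType} (x y : D) (a b : R).
Local Notation K := {fraction D}.

Definition spaceX : Type := {W : set K | W \in val_overrings x y a b}.
HB.instance Definition _ := Choice.on spaceX.

(* spaceX is equipped with two topologies, hence the two aliases. *)
Definition zariskiX : Type := spaceX.
HB.instance Definition _ := Choice.on zariskiX.

Definition patchX : Type := spaceX.
HB.instance Definition _ := Choice.on patchX.

Definition zariski_basic (F : set K) : set zariskiX :=
  [set V : zariskiX | F `<=` val V].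

Definition patch_basic (FG : set K * set K) : set patchX :=
  [set V : patchX | FG.1 `<=` val V /\ FG.2 `<=` nonunits (val V)].

Lemma zariski_basic_cover :
  \bigcup_(F in [set F | finite_set F]) zariski_basic F = setT.
Proof. by rewrite -subTset => V _; exists set0; [exact: finite_set0 | move=> z]. Qed.

Lemma zariski_basic_join (F F' : set K) (V : zariskiX) :
  finite_set F -> finite_set F' -> zariski_basic F V -> zariski_basic F' V ->
  exists F'', [/\ finite_set F'', zariski_basic F'' V
    & zariski_basic F'' `<=` zariski_basic F `&` zariski_basic F'].
Proof.
move=> fF fF' FV F'V; exists (F `|` F'); split.
- by rewrite finite_setU.
- by rewrite /zariski_basic /= subUset.
- by move=> W; rewrite /zariski_basic /= subUset.
Qed.

HB.instance Definition _ := isBaseTopological.Build zariskiX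
  zariski_basic_cover zariski_basic_join.

Lemma patch_basic_cover :
  \bigcup_(FG in [set FG | finite_set FG.1 /\ finite_set FG.2]) patch_basic FG
  = setT.
Proof.
rewrite -subTset => V _; exists (set0, set0); last by split=> z.
by split; exact: finite_set0.
Qed.

Lemma patch_basic_join (FG FG' : set K * set K) (V : patchX) :
  finite_set FG.1 /\ finite_set FG.2 -> finite_set FG'.1 /\ finite_set FG'.2 ->
  patch_basic FG V -> patch_basic FG' V ->
  exists FG'', [/\ finite_set FG''.1 /\ finite_set FG''.2, patch_basic FG'' V
    & patch_basic FG'' `<=` patch_basic FG `&` patch_basic FG'].
Proof.
move=> [f1 f2] [f1' f2'] [V1 V2] [V1' V2'].
exists (FG.1 `|` FG'.1, FG.2 `|` FG'.2); split => /=.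
- by rewrite !finite_setU.
- by rewrite /patch_basic /= !subUset.
- by move=> W; rewrite /patch_basic /= !subUset => -[[? ?] [? ?]].
Qed.

HB.instance Definition _ := isBaseTopological.Build patchX
  patch_basic_cover patch_basic_join.

Definition same_rank1 (V W : spaceX) : bool :=
  `[< rank1_overrings (val V) = rank1_overrings (val W) >].

Lemma same_rank1_refl : reflexive same_rank1.
Proof. by move=> V; apply/asboolP. Qed.

Lemma same_rank1_sym : symmetric same_rank1.
Proof. by move=> V W; apply/asboolP/asboolP => ->. Qed.

Lemma same_rank1_trans : transitive same_rank1.
Proof. by move=> V W U /asboolP e /asboolP e'; apply/asboolP; rewrite e. Qed.

Canonical same_rank1_equiv :=
  EquivRel same_rank1 same_rank1_refl same_rank1_sym same_rank1_trans.

Definition quotX : quotType spaceX := {eq_quot same_rank1_equiv}.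

Definition patch_quotX : topologicalType :=
  @quotient_topology patchX quotX.

Definition zariski_quotX : topologicalType :=
  @quotient_topology zariskiX quotX.

End Space.

Definition homeomorphism (T U : topologicalType) (f : T -> U) : Prop :=
  exists g : U -> T, [/\ cancel f g, cancel g f, continuous f & continuous g].

(* Main.v *)
Require Import Defs.
From mathcomp Require Import all_boot all_order all_algebra.
From mathcomp Require Import fraction generic_quotient.
From mathcomp Require Import all_classical all_reals all_analysis.
From mathcomp Require Import ring lra zify.
Import Order.TTheory GRing.Theory Num.Theory.
Import numFieldNormedType.Exports.
Local Open Scope classical_set_scope.
Local Open Scope ring_scope.
Local Open Scope quotient_scope.
Set Implicit Arguments.
Unset Strict Implicit.
Unset Printing Implicit Defensive.

(** A representation of [f] as an antichain of monomials with unit coefficients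
    is obtained from the fact that [x, y] is a regular sequence, so that [D / (x)]
    and [D / (y)] are discrete valuation rings ([power_decomposition],
    [regular_mod]). Regularity comes from dimension two: if [y] were nilpotent
    modulo [x], every nonzero prime would contain [x] and the dimension would be
    at most one ([principal_ideal_height]). The exponents that lie above some
    monomial of [f] are those [(p, q)] for which [f] is outside the ideal
    $(x^{p+1}, y^{q+1})$ ([monomial_rep_box]). Hence $v_r(f)$ is the minimum of
    $p + qr$ over these exponents, whatever the representation, and it is
    multiplicative ([nuM]). Its valuation ring $V_r$ has rank one because its
    value group is archimedean ([mval_ring_krull_dim]).

    Let [W] be a valuation overring of $T_I$ other than [K], with valuation $w$.
    An element of [K] whose value $v_t$ is positive for all $t$ in [[a, b]] lies
    in $T_I$ ([interval_ring_pos]). Applied to fractions of monomials, this shows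
    that $w(x)$ and $w(y)$ are positive and that the ratio
    $r = w(y)/w(x)$ is a real number in [[a, b]] ([slope_itv]). Given [f] in [D],
    let $m$ be a monomial of [f] of minimal weight at $r$; since
    $v_t(f) \le v_t(m)$ for every $t$, the fractions $m^N x / f^N$ lie in $T_I$,
    so $w(f)$ is bounded by $w(m)$ up to an arbitrarily small fraction of $w(x)$.
    It follows that [W] is contained in $V_r$ ([overring_sub_mval_ring]).
    Comparability of the overrings of [W] makes $V_r$ its only rank one valuation
    overring ([rank1_overringE]). This defines the map from [X] to the interval,
    and the classes of the equivalence relation are its fibres
    ([same_rank1E]).

    This map is Zariski continuous, because $p/q < r$ is witnessed by $y^q/x^p$
    in [W], and $p/q > r$ by $x^p/y^q$ ([slopeX_continuous]); it is then
    continuous for the finer patch topology. The patch topology is compact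
    ([patchX_compact]), so the bijection from the patch quotient to the Hausdorff
    interval is a homeomorphism. The Zariski quotient has fewer open sets than
    the patch quotient, so the inverse is continuous for it as well. *)

(** * Ideals and the ascending chain condition *)

Section IdealsOfARing.
Context {S : comNzRingType}.
Implicit Types (J M : set S) (f g c : S).

Lemma ideal_sum J n (F : 'I_n -> S) :
  ideal setT J -> (forall i, J (F i)) -> J (\sum_i F i).
Proof. by case=> _ J0 JD _ JF; elim/big_ind: _. Qed.

Lemma ideal_span2 x y f :
  ideal_span [:: x; y] f <-> exists c d, f = c * x + d * y.
Proof.
split=> [[c _ <-]|[c [d ->]]].
  by exists (c ord0), (c (lift ord0 ord0)); rewrite /= big_ord_recl big_ord1.
exists (fun i => if i == ord0 then c else d) => //.
by rewrite /= big_ord_recl big_ord1.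
Qed.

(** The union of the chain is an ideal, and its finitely many generators all
    appear at some finite stage. *)
Lemma noetherian_acc (J : nat -> set S) : noetherian S ->
  (forall n, ideal setT (J n)) -> (forall n, J n `<=` J n.+1) ->
  exists n, forall k, J k `<=` J n.
Proof.
move=> noeS idJ incJ.
have monJ m n : (m <= n)%N -> J m `<=` J n.
  by move=> /subnK <-; elim: (n - m)%N => // k IH f /IH; exact: incJ.
have [|s sE] := noeS (\bigcup_n J n).
  split=> //; first by exists 0%N => //; case: (idJ 0%N).
    move=> u v [m _ Ju] [n _ Jv]; exists (maxn m n) => //.
    case: (idJ (maxn m n)) => _ _ JD _.
    by apply: JD; [move: Ju | move: Jv]; apply: monJ; rewrite (leq_maxl, leq_maxr).
  by move=> c u _ [n _ Ju]; exists n => //; case: (idJ n) => _ _ _; exact.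
have s_in (i : 'I_(size s)) : exists n, J n s`_i.
  have : (\bigcup_n J n) s`_i.
    rewrite sE; exists (fun j => (i == j)%:R) => //.
    rewrite (bigD1 i)//= eqxx mul1r big1 ?addr0// => j ji.
    by rewrite eq_sym (negPf ji) mul0r.
  by case=> n _; exists n.
have [N JN] := choice s_in.
exists (\max_i N i)%N => k f Jf.
have : (\bigcup_n J n) f by exists k.
rewrite sE => -[c _ <-]; apply: ideal_sum => // i.
case: (idJ (\max_i N i)%N) => _ _ _; apply=> //.
by apply: monJ (JN i); rewrite (leq_bigmax i).
Qed.

(** Zorn is applied to the sets [M] with [J `|` M] a proper ideal rather than to
    the proper ideals containing [J], so that the union of the empty chain is
    not an exception. *)
Lemma proper_ideal_maximal J : ideal setT J -> ~ J 1 ->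
  exists2 M, maximal_ideal setT M & J `<=` M.
Proof.
move=> idJ J1.
pose proper M := ideal setT (J `|` M) /\ ~ (J `|` M) 1.
have [F Fproper totF|A [[idA A1] maxA]] := @Zorn_bigcup S proper.
  have [J_sub J0 JD JM] := idJ.
  split; last by case=> // -[M FM M1]; case: (Fproper M FM) => _; apply; right.
  split=> //; first by left.
    move=> u v [Ju|[M FM Mu]] [Jv|[N FN Nv]].
    - by left; exact: JD.
    - have [[_ _ + _] _] := Fproper N FN => /(_ u v (or_introl Ju) (or_intror Nv)).
      by case=> ?; [left | right; exists N].
    - have [[_ _ + _] _] := Fproper M FM => /(_ u v (or_intror Mu) (or_introl Jv)).
      by case=> ?; [left | right; exists M].
    - have [MN|NM] := totF _ _ FM FN.
        have [[_ _ + _] _] := Fproper N FN.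
        move=> /(_ u v (or_intror (MN _ Mu)) (or_intror Nv)).
        by case=> ?; [left | right; exists N].
      have [[_ _ + _] _] := Fproper M FM.
      move=> /(_ u v (or_intror Mu) (or_intror (NM _ Nv))).
      by case=> ?; [left | right; exists M].
  move=> c u _ [Ju|[M FM Mu]]; first by left; exact: JM.
  have [[_ _ _ +] _] := Fproper M FM => /(_ c u I (or_intror Mu)).
  by case=> ?; [left | right; exists M].
exists (J `|` A); last by left.
split=> // M idM M1 JAM.
have JM : J `|` M = M by apply/setUidr => f Jf; apply: JAM; left.
have properM : proper M by rewrite /proper JM.
apply/seteqP; split=> // f Mf; right; apply: contrapT => nAf.
apply: maxA properM; rewrite properEneq; split; last by move=> g Ag; apply: JAM; right.
by apply/eqP => AM; rewrite AM in nAf.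
Qed.

End IdealsOfARing.

(** * Krull intersection along one element *)

Section PrincipalKrull.
Context {S : comUnitRingType}.
Implicit Types (J : set S) (f g c : S).

(** Krull's intersection theorem in [S / J], for the powers of a single element
    [y] such that all [1 - c * y] are units. Only two ascending chains are
    needed. First, the annihilators of the powers of [y] modulo [J] stabilize at
    some [y ^+ n]. Writing [f = g k * y ^+ k] modulo [J], the elements
    [h k = g (n + k) * y ^+ n] then satisfy [h k = h k.+1 * y] modulo [J], so the
    ideals [J + (h k)] increase; when they stabilize, [h m.+1] is a multiple of
    [y * h m.+1] modulo [J], hence is in [J], and so is [f]. *)
Lemma krull_intersection J y f : noetherian S -> ideal setT J ->
  (forall c, 1 - c * y \is a GRing.unit) ->
  (forall n, exists g, J (f - g * y ^+ n)) -> J f.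
Proof.
move=> noeS [J_sub J0 JD JM] y_rad /choice[g fg].
have [||n stable] := @noetherian_acc _ (fun n => [set h | J (h * y ^+ n)]) noeS.
- move=> n; split=> // [|u v Ju Jv|c u _ Ju] /=; first by rewrite mul0r.
    by rewrite mulrDl; exact: JD.
  by rewrite -mulrA; exact: JM.
- move=> n h Jh; rewrite /= exprS mulrCA; exact: JM.
pose h k := g (n + k)%N * y ^+ n.
have h_step k : J (h k - h k.+1 * y).
  rewrite /h -mulrA -exprSr exprS mulrA -mulrBl.
  apply: (stable (n + k)%N); rewrite /= mulrBl -mulrA -exprS addnS.
  have := JD _ _ (fg (n + k).+1) (JM (-1) _ I (fg (n + k)%N)).
  by congr J; ring.
have [||m stable_h] := @noetherian_acc _
    (fun k => [set t | exists c, J (t - c * h k)]) noeS.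
- move=> k; split=> // [|u v [c Ju] [d Jv]|c u _ [d Ju]].
  + by exists 0; rewrite mul0r subr0.
  + by exists (c + d); have := JD _ _ Ju Jv; congr J; ring.
  + by exists (c * d); have := JM c _ I Ju; congr J; ring.
- move=> k t [c Jt]; exists (c * y).
  by have := JD _ _ Jt (JM c _ I (h_step k)); congr J; ring.
have [|c Jc] := stable_h m.+1 (h m.+1); first by exists 1; rewrite mul1r subrr.
have Jh : J (h m.+1).
  have := JD _ _ Jc (JM c _ I (h_step m)).
  rewrite [X in J X](_ : _ = (1 - c * y) * h m.+1); last by ring.
  by move=> /(JM (1 - c * y)^-1 _ I); rewrite mulrA mulVr ?mul1r ?y_rad.
have := JD _ _ (fg (n + m.+1)%N) (JM (y ^+ m.+1) _ I Jh).
by rewrite /h exprD; congr J; ring.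
Qed.

End PrincipalKrull.

(** * Local domains with a two-generated maximal ideal *)

Section LocalRing.
Context {D : idomainType}.
Implicit Types (x y f g c d : D) (J P : set D).

(** What regularity says apart from the dimension: the ring is noetherian, and its
    nonunits are exactly the combinations of [x] and [y]. *)
Definition local_with x y : Prop :=
  [/\ noetherian D, forall f, f \isn't a GRing.unit -> exists c d, f = c * x + d * y
    & forall c d, c * x + d * y \isn't a GRing.unit].

Lemma local_with_sym x y : local_with x y -> local_with y x.
Proof.
case=> noeD nu_span span_nu; split=> // [f /nu_span[c [d ->]]|c d].
  by exists d, c; rewrite addrC.
by rewrite addrC.
Qed.

Lemma local_unitB x y c d : local_with x y -> 1 - (c * x + d * y) \is a GRing.unit.
Proof.
case=> _ nu_span span_nu; apply: contraT => /nu_span[c' [d' e]].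
have := span_nu (c + c') (d + d').
suff -> : (c + c') * x + (d + d') * y = 1 by rewrite unitr1.
by rewrite -[RHS](subrK (c * x + d * y)) e; ring.
Qed.

Lemma local_unitDr x y u f c d : local_with x y -> u \is a GRing.unit ->
  f = c * x + d * y -> u + f \is a GRing.unit.
Proof.
move=> lxy uu ->; rewrite -[u](mulr1 u).
rewrite (_ : _ + _ = u * (1 - ((- u^-1 * c) * x + (- u^-1 * d) * y))).
  by rewrite unitrM uu /= (local_unitB _ _ lxy).
rewrite mulrBr mulrDr !mulrA !mulrN divrr// !mulr1; ring.
Qed.

Lemma ideal0 : ideal setT [set 0 : D].
Proof.
by split=> // [u v /= -> ->|c u _ /= ->]; rewrite ?addr0 ?mulr0.
Qed.

Lemma ideal_principal x : ideal setT [set f | exists c, f = c * x].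
Proof.
split=> // [|u v [c ->] [d ->]|c u _ [d ->]]; first by exists 0; rewrite mul0r.
  by exists (c + d); rewrite mulrDl.
by exists (c * d); rewrite mulrA.
Qed.

(** [D / (x)] is local with maximal ideal generated by the image of [y], so by
    Krull's intersection theorem every nonzero class is a unit times a power
    of [y]. *)
Lemma power_decomposition x y f : local_with x y ->
  (exists c, f = c * x) \/
  exists n u g, u \is a GRing.unit /\ f = u * y ^+ n + g * x.
Proof.
move=> lxy; have [noeD nu_span _] := lxy.
have [?|nfx] := pselect (exists c, f = c * x); [by left | right].
have [n n_bad] : exists n, ~ exists g c, f = g * y ^+ n + c * x.
  apply: contrapT => all_n; apply: nfx.
  apply: (krull_intersection (y := y) noeD (ideal_principal x)) => [c|n].
    by rewrite -[c * y]add0r -[0](mul0r x) (local_unitB _ _ lxy).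
  have [g [c ->]] : exists g c, f = g * y ^+ n + c * x.
    by apply: contrapT => ?; apply: all_n; exists n.
  by exists g, c; ring.
elim: n n_bad => [[]|n IHn n_bad]; first by exists f, 0; ring.
have [[g [c fE]]|/IHn//] := pselect (exists g c, f = g * y ^+ n + c * x).
exists n, g, c; split=> //; apply: contraT => /nu_span[c' [d' gE]].
by case: n_bad; exists d', (c + c' * y ^+ n); rewrite fE gE exprS; ring.
Qed.

Lemma domain_power_decomposition x y f : local_with x y -> f != 0 ->
  exists n g, f = g * x ^+ n /\ ~ exists c, g = c * x.
Proof.
move=> lxy f0; have [noeD nu_span _] := lxy.
have [n n_bad] : exists n, ~ exists g, f = g * x ^+ n.
  apply: contrapT => all_n; move/eqP: f0; apply.
  apply: (krull_intersection (y := x) noeD ideal0) => [c|n].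
    by rewrite -[c * x]addr0 -[0](mul0r y) (local_unitB _ _ lxy).
  have [g ->] : exists g, f = g * x ^+ n.
    by apply: contrapT => ?; apply: all_n; exists n.
  by exists g; rewrite /= subrr.
elim: n n_bad => [[]|n IHn n_bad]; first by exists f; rewrite expr0 mulr1.
have [[g fE]|/IHn//] := pselect (exists g, f = g * x ^+ n).
exists n, g; split=> // -[c gE].
by case: n_bad; exists c; rewrite fE gE exprS mulrA.
Qed.

(** The principal ideal theorem in the only case needed: if [y] is nilpotent
    modulo [x], then a nonzero prime ideal contains [x]. If [P] did not, let
    [J k] be the ideal of the [f] some [x]-power multiple of which lies in
    [(z ^+ k)]. Modulo [x] every ideal is generated by a power of [y], and [y] is
    nilpotent, so the images of the [J k] cannot decrease strictly forever; for
    some [k] this gives [J k] inside [J k.+1 + (x)], hence inside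
    [J k.+1 + x * J k] because [x] can be cancelled in [J k]. The intersection
    theorem turns this into [J k = J k.+1]; thus [x ^+ j * z ^+ k] is a multiple
    of [z ^+ k.+1], and [x ^+ j] is in [P]. *)
Lemma principal_ideal_height x y z P n c : local_with x y ->
  prime_ideal setT P -> P z -> z != 0 -> y ^+ n = c * x -> P x.
Proof.
move=> lxy [[P_sub P0 PD PM] P1 Pprime] Pz z0 ync.
have [noeD nu_span _] := lxy.
apply: contrapT => nPx.
pose J k : set D := [set f | exists j d, x ^+ j * f = d * z ^+ k].
have idJ k : ideal setT (J k).
  split=> // [|u v [i [d ue]] [j [e ve]]|a u _ [i [d ue]]].
  - by exists 0%N, 0; rewrite mulr0 mul0r.
  - exists (i + j)%N, (x ^+ j * d + x ^+ i * e).
    rewrite mulrDr {1}(addnC i j) !exprD -!mulrA ue ve; ring.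
  - by exists i, (a * d); rewrite mulrCA ue mulrA.
have decJ k f : J k.+1 f -> J k f.
  by case=> j [d e]; exists j, (d * z); rewrite e exprS mulrA.
pose Jx k : set D := [set f | exists d, J k (f - d * x)].
have idJx k : ideal setT (Jx k).
  have [_ J0 JD JM] := idJ k.
  split=> // [|u v [d Ju] [e Jv]|a u _ [d Ju]].
  - by exists 0; rewrite mul0r subr0.
  - by exists (d + e); have := JD _ _ Ju Jv; congr J; ring.
  - by exists (a * d); have := JM a _ I Ju; congr J; ring.
have Jx_x k d : Jx k (d * x) by exists d; rewrite subrr; case: (idJ k).
have [k Jk] : exists k, J k `<=` Jx k.+1.
  apply: contrapT => noJ.
  (* Each strict decrease of J k modulo x raises the least power of y in it. *)
  suff low k i : (i < k)%N -> ~ Jx k (y ^+ i).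
    by have := low n.+1 n (ltnSn n); apply; rewrite ync.
  elim: k i => [//|k IHk] i ik Jyi; apply: noJ; exists k => f Jf.
  have [_ _ JxD JxM] := idJx k; have [_ _ JxD' JxM'] := idJx k.+1.
  have [[d ->]//|[m [u [g [uu fE]]]]] := power_decomposition f lxy.
  have km : (k <= m)%N.
    rewrite leqNgt; apply/negP => /IHk; apply.
    have -> : y ^+ m = u^-1 * (f + (- g) * x) by rewrite fE mulNr addrK mulKr.
    by apply: JxM => //; apply: JxD; [exists 0; rewrite mul0r subr0 | exact: Jx_x].
  rewrite fE; apply: JxD'; last exact: Jx_x.
  have im : (i <= m)%N by apply: leq_trans km; rewrite -ltnS.
  by apply: (JxM') => //; rewrite -(subnK im) exprD; exact: JxM'.
(* Iterating J k <= J k.+1 + x J k, the form required by krull_intersection. *)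
have Jk_pow m f : J k f -> exists2 g, J k g & J k.+1 (f - g * x ^+ m).
  have [_ J0 JD JM] := idJ k; have [_ J0' JD' JM'] := idJ k.+1.
  elim: m f => [|m IHm] f Jf; first by exists f; rewrite ?mulr1 ?subrr.
  have [g Jg Jfg] := IHm _ Jf; have [d Jgd] := Jk _ Jg.
  exists d.
    have [j [e ej]] : J k (d * x).
      have := JD _ _ Jg (JM (-1) _ I (decJ _ _ Jgd)).
      by congr J; ring.
    by exists j.+1, e; rewrite exprSr -mulrA (mulrC x).
  have := JD' _ _ Jfg (JM' (x ^+ m) _ I Jgd); congr J; rewrite exprS; ring.
have Jz : J k (z ^+ k) by exists 0%N, 1.
have : J k.+1 (z ^+ k).
  apply: (krull_intersection (y := x) noeD (idJ k.+1)) => [d|m].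
    by rewrite -[d * x]addr0 -[0](mul0r y) (local_unitB _ _ lxy).
  by have [g _ ?] := Jk_pow m _ Jz; exists g.
case=> j [d]; rewrite exprS mulrA => /(mulIf (expf_neq0 k z0)) xj.
have Pxj : P (x ^+ j) by rewrite xj; exact: PM.
elim: j Pxj {xj} => [//|j IHj]; rewrite exprS.
by case/(Pprime x (x ^+ j) I I).
Qed.

Lemma regular_local_local_with x y :
  regular_local_ring_with [:: x; y] -> local_with x y.
Proof.
case=> noeD maxE _; split=> // [f nuf|c d].
  have [] := @proper_ideal_maximal _ _ (ideal_principal f).
    case=> c e; move/negP: nuf; apply; apply/unitrP; exists c.
    by rewrite (mulrC f) -e.
  by move=> M /maxE -> fM; apply/ideal_span2/fM; exists 1; rewrite mul1r.
apply/negP => /unitrP[v [v1 _]].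
have /maxE[[_ _ _ MM] M1 _] := erefl (ideal_span [:: x; y]).
by apply: M1; rewrite -v1; apply: MM => //; apply/ideal_span2; exists c, d.
Qed.

Lemma regular_local_sym x y :
  regular_local_ring_with [:: x; y] -> regular_local_ring_with [:: y; x].
Proof.
case=> noeD maxE dimD; split=> // M; rewrite maxE.
suff -> : ideal_span [:: x; y] = ideal_span [:: y; x] by [].
by apply/seteqP; split=> f /ideal_span2[c [d ->]]; apply/ideal_span2;
  exists d, c; rewrite addrC.
Qed.

(** Otherwise the middle term of a chain of three primes, being nonzero, would
    contain [x], then [y], then the whole maximal ideal. *)
Lemma regular_local_not_nilpotent x y n c :
  regular_local_ring_with [:: x; y] -> y ^+ n <> c * x.
Proof.
move=> hD ync; have lxy := regular_local_local_with hD.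
have [_ nu_span _] := lxy.
case: hD => _ _ [[P [Pprime Pinc]] _].
pose i1 : 'I_3 := Ordinal (isT : (1 < 3)%N).
have [P01 /existsNP[z /not_implyP[Pz nPz]]] := Pinc ord0 i1 isT.
have [P12 nP21] := Pinc i1 ord_max isT.
have z0 : z != 0.
  by apply/eqP => z0; apply: nPz; rewrite z0; case: (Pprime ord0) => -[].
have Px := principal_ideal_height lxy (Pprime i1) Pz z0 ync.
have [[P_sub P0 PD PM] P1 P1prime] := Pprime i1.
have Py : P i1 y.
  have : P i1 (y ^+ n) by rewrite ync; exact: PM.
  elim: (n) => [//|m IHm]; rewrite exprS.
  by case/(P1prime y (y ^+ m) I I).
apply: nP21 => f Pf.
have [[_ _ _ PM2] P21 _] := Pprime ord_max.
have [c' [d' ->]] : exists c d, f = c * x + d * y.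
  apply: nu_span; apply/negP => uf; apply: P21.
  by rewrite -(mulVr uf); exact: PM2.
by apply: PD; exact: PM.
Qed.

End LocalRing.

(** * Monomial expansions in a two-dimensional regular local ring *)

Section RegularPair.
Context {D : idomainType}.
Implicit Types (x y f g c d u : D).

(** [x, y] is a regular sequence: if [x] did not divide [g], then [g] would be a
    unit times a power of [y] modulo [x], and [y] would be nilpotent modulo [x]. *)
Lemma regular_mod x y n g c : regular_local_ring_with [:: x; y] ->
  y ^+ n * g = c * x -> exists d, g = d * x.
Proof.
move=> hD ygc; have lxy := regular_local_local_with hD.
have [//|[m [u [h [uu gE]]]]] := power_decomposition g lxy.
case: (@regular_local_not_nilpotent _ _ _ (n + m) (u^-1 * (c - h * y ^+ n)) hD).
rewrite exprD -[LHS](mulKr uu) -mulrA; congr (_ * _).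
by rewrite mulrBl -ygc gE; ring.
Qed.

Lemma parameter_neq0 x y : regular_local_ring_with [:: x; y] -> x != 0.
Proof.
move=> /regular_local_sym /regular_local_not_nilpotent nx.
by apply/eqP => x0; case: (nx 1%N 0); rewrite expr1 mul0r.
Qed.

Lemma regular_mod_pow x y n p g c : regular_local_ring_with [:: x; y] ->
  y ^+ n * g = c * x ^+ p -> exists d, g = d * x ^+ p.
Proof.
move=> hD; elim: p g c => [|p IHp] g c; first by exists g; rewrite mulr1.
have x0 := parameter_neq0 hD.
rewrite exprSr mulrA => /[dup] /(regular_mod hD)[h ->].
rewrite mulrA => /(mulIf x0) /IHp[d ->].
by exists d; rewrite mulrA.
Qed.

(** The monomial ideal $(x^{p+1}, y^{q+1})$ for [e = (p, q)]. It contains every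
    monomial that does not divide $x^p y^q$. The exponents [e] for which [f] is
    outside [box e] form the up-closed set generated by the monomials of any
    representation of [f], which gives access to the monomials of [f]
    independently of the representation. *)
Definition box x y (e : nat * nat) : set D :=
  [set f | exists c d, f = c * x ^+ e.1.+1 + d * y ^+ e.2.+1].

Definition expo_le (e e' : nat * nat) := ((e.1 <= e'.1) && (e.2 <= e'.2))%N.

Definition expo_add (e e' : nat * nat) := (e.1 + e'.1, e.2 + e'.2)%N.

Lemma monomialE x y p q : monomial x y (p, q) = x ^+ p * y ^+ q.
Proof. by []. Qed.

Lemma monomialD x y e e' :
  monomial x y (expo_add e e') = monomial x y e * monomial x y e'.
Proof. by rewrite /monomial /= !exprD; ring. Qed.

Lemma box_ideal x y e : ideal setT (box x y e).
Proof.
split=> // [|u v [a [b ->]] [c [d ->]]|c u _ [a [b ->]]].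
- by exists 0, 0; rewrite !mul0r addr0.
- by exists (a + c), (b + d); ring.
- by exists (c * a), (c * b); ring.
Qed.

Lemma monomial_box x y e e' c : ~~ expo_le e' e -> box x y e (c * monomial x y e').
Proof.
rewrite negb_and -!ltnNge => /orP[] lt; rewrite /monomial -(subnK lt) exprD.
  by exists (c * x ^+ (e'.1 - e.1.+1) * y ^+ e'.2), 0; ring.
by exists 0, (c * x ^+ e'.1 * y ^+ (e'.2 - e.2.+1)); ring.
Qed.

Lemma box_anti x y e e' f : expo_le e e' -> box x y e' f -> box x y e f.
Proof.
move=> /andP[le1 le2] [c [d ->]].
exists (c * x ^+ (e'.1 - e.1)), (d * y ^+ (e'.2 - e.2)).
by rewrite -!mulrA -!exprD !addnS !subnK.
Qed.

(** From $u x^p y^q = c x^{p+1} + d y^{q+1}$, cancelling $x^p$ modulo $y^{q+1}$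
    leaves a unit multiple of $y^q$ in [(x)], which regularity forbids. *)
Lemma monomial_not_box x y e u : regular_local_ring_with [:: x; y] ->
  u \is a GRing.unit -> ~ box x y e (u * monomial x y e).
Proof.
move=> hD uu [c [d e1]]; have hD' := regular_local_sym hD.
have lxy := regular_local_local_with hD.
have [|d' dE] := @regular_mod_pow y x e.1 e.2.+1 (u * y ^+ e.2 - c * x) d hD'.
  by rewrite -(addKr (c * x ^+ e.1.+1) (d * _)) -e1 /monomial exprS; ring.
have uu' : u + (- d') * y \is a GRing.unit.
  by apply: (local_unitDr (c := 0) (d := - d') lxy uu); rewrite mul0r add0r.
apply: (@regular_local_not_nilpotent _ x y e.2 ((u + (- d') * y)^-1 * c) hD).
rewrite -[LHS](mulKr uu') -mulrA; congr (_ * _).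
by rewrite -[c * x](subKr (u * y ^+ e.2)) dE exprS; ring.
Qed.

Lemma dividesE x y e e' : regular_local_ring_with [:: x; y] ->
  divides (monomial x y e) (monomial x y e') <-> expo_le e e'.
Proof.
move=> hD; split=> [[c cE]|/andP[le1 le2]].
  apply: contraT => nle; case: (monomial_not_box (e := e') (u := 1) hD).
    exact: unitr1.
  by rewrite cE mul1r; exact: monomial_box.
exists (monomial x y (e'.1 - e.1, e'.2 - e.2)%N); rewrite -monomialD.
by rewrite /expo_add /= !subnK//; case: (e').
Qed.

(** The sequence form of [monomial_rep], with divisibility of monomials replaced
    by comparison of exponents; it is stable under the filtering and
    concatenation used to build representations. *)
Definition antichain_sum x y (s : seq (D * (nat * nat))) f : Prop :=
  [/\ f = \sum_(t <- s) t.1 * monomial x y t.2,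
      forall t, t \in s -> t.1 \is a GRing.unit,
      uniq (map snd s)
    & forall t t', t \in s -> t' \in s -> expo_le t.2 t'.2 -> t.2 = t'.2].

Lemma antichain_sum_unit x y f : f \is a GRing.unit ->
  antichain_sum x y [:: (f, (0, 0)%N)] f.
Proof.
move=> uf; split=> //; first by rewrite big_seq1 /monomial /= !expr0 !mulr1.
  by move=> t; rewrite inE => /eqP ->.
by move=> t t'; rewrite !inE => /eqP -> /eqP ->.
Qed.

Lemma antichain_sum_shift x y s f a b : antichain_sum x y s f ->
  antichain_sum x y [seq (t.1, expo_add (a, b) t.2) | t <- s]
    (f * monomial x y (a, b)).
Proof.
move=> [fE us uniqs anti].
have shift_inj : injective (expo_add (a, b)).
  by move=> [p q] [p' q'] [] /= /addnI -> /addnI ->.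
split.
- rewrite big_map {1}fE mulr_suml; apply: eq_bigr => t _ /=.
  by rewrite monomialD; ring.
- by move=> _ /mapP[t ts ->]; exact: (us t).
- have -> : map snd [seq (t.1, expo_add (a, b) t.2) | t <- s] =
      map (expo_add (a, b)) (map snd s) by rewrite -!map_comp.
  by rewrite map_inj_uniq.
- move=> _ _ /mapP[t ts ->] /mapP[t' ts' ->] /= le; congr expo_add.
  by apply: anti => //; move: le; rewrite /expo_le /= !leq_add2l.
Qed.

(** Adding the pure power $v x^n$ to an antichain all of whose terms are divisible
    by [y]: the terms divisible by $x^n$ are absorbed in its coefficient, which
    remains a unit since they change it by a multiple of [y]. *)
Lemma antichain_sum_absorb x y s h f v n : local_with x y ->
  antichain_sum x y s h -> v \is a GRing.unit ->
  f = v * x ^+ n + h * y -> exists s', antichain_sum x y s' f.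
Proof.
move=> lxy hs uv fE.
have [hyE us uniqs anti] := antichain_sum_shift 0 1 hs.
rewrite (monomialE _ _ 0 1) expr0 mul1r expr1 in hyE.
set s1 := map _ s in hyE us uniqs anti.
have s1_pos t : t \in s1 -> (0 < t.2.2)%N by case/mapP=> t0 _ ->.
pose far := [pred t : D * (nat * nat) | n <= t.2.1]%N.
pose w := v + \sum_(t <- s1 | far t) t.1 * monomial x y (t.2.1 - n, t.2.2)%N.
exists ((w, (n, 0)%N) :: [seq t <- s1 | ~~ far t]); split.
- rewrite big_cons fE hyE (bigID far) /= big_filter addrA; congr (_ + _).
  rewrite /w mulrDl; congr (_ + _); first by rewrite monomialE expr0 mulr1.
  rewrite mulr_suml; apply: eq_bigr => t nt.
  rewrite -mulrA -monomialD /expo_add /= subnK// addn0.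
  by case: (t.2).
- move=> t; rewrite inE mem_filter => /orP[/eqP ->|/andP[_ /us]//].
  have [c ->] : exists c, w = v + c * y.
    rewrite /w big_seq_cond; elim/big_rec: _ => [|t0 z /andP[/s1_pos t0_pos _] [c zE]].
      by exists 0; rewrite mul0r.
    exists (c + t0.1 * x ^+ (t0.2.1 - n) * y ^+ t0.2.2.-1).
    rewrite addrCA zE /monomial /= -{1}(prednK t0_pos) exprS; ring.
  by apply: (local_unitDr (c := 0) (d := c) lxy uv); rewrite mul0r add0r.
- rewrite /= (subseq_uniq _ uniqs) ?map_subseq ?filter_subseq// andbT.
  by apply/mapP => -[t]; rewrite mem_filter => /andP[/= + _] tE; rewrite -tE leqnn.
- move=> t t'; rewrite !inE !mem_filter.
  move=> /orP[/eqP ->|/andP[nt ts]] /orP[/eqP ->|/andP[nt' ts']] //.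
  + by rewrite /expo_le /= => /andP[nt'' _]; case/negP: nt'.
  + by rewrite /expo_le /= => /andP[_]; rewrite leqNgt s1_pos.
  + exact: anti.
Qed.

(** Induction on the order [q] of [f] modulo [x]. Modulo [y], [f] is zero or a
    unit times a power of [x]; what remains is [y] times an element of order
    [q - 1] modulo [x]. *)
Lemma antichain_sum_mod x y q f u g : regular_local_ring_with [:: x; y] ->
  u \is a GRing.unit -> f = u * y ^+ q + g * x -> exists s, antichain_sum x y s f.
Proof.
move=> hD uu; have lxy := regular_local_local_with hD.
elim: q f g => [|q IHq] f g fE.
  exists [:: (f, (0, 0)%N)]; apply: antichain_sum_unit; rewrite fE expr0 mulr1.
  by apply: (local_unitDr (c := g) (d := 0) lxy uu); rewrite mul0r addr0.
have [[c cE]|[n [v [h [uv hE]]]]] := power_decomposition f (local_with_sym lxy).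
  have [|d dE] := @regular_mod x y 1 (c - u * y ^+ q) g hD.
    by rewrite expr1 -(addKr (u * y ^+ q.+1) (g * x)) -fE cE exprS; ring.
  have [|s cs] := IHq c d; first by rewrite -dE; ring.
  have := antichain_sum_shift 0 1 cs.
  by rewrite monomialE expr0 mul1r expr1 -cE; eexists; eassumption.
case: n hE => [|n] hE.
  exists [:: (f, (0, 0)%N)]; apply: antichain_sum_unit; rewrite hE expr0 mulr1.
  by apply: (local_unitDr (c := 0) (d := h) lxy uv); rewrite mul0r add0r.
have [|d dE] := @regular_mod x y 1 (h - u * y ^+ q) (g - v * x ^+ n) hD.
  rewrite expr1 mulrBl -(addKr (u * y ^+ q.+1) (g * x)) -fE hE !exprS; ring.
have [|s hs] := IHq h d; first by rewrite -dE; ring.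
exact: (antichain_sum_absorb lxy hs uv hE).
Qed.

Lemma antichain_sum_exists x y f : regular_local_ring_with [:: x; y] -> f != 0 ->
  exists s, antichain_sum x y s f.
Proof.
move=> hD f0; have lxy := regular_local_local_with hD.
have [n [g [-> ngx]]] := domain_power_decomposition lxy f0.
have [//|[q [u [h [uu gE]]]]] := power_decomposition g lxy.
have [s gs] := antichain_sum_mod hD uu gE.
have := antichain_sum_shift n 0 gs.
by rewrite monomialE expr0 mulr1; eexists; eassumption.
Qed.

Lemma monomial_rep_exists x y f : regular_local_ring_with [:: x; y] -> f != 0 ->
  exists n (u : 'I_n -> D) (e : 'I_n -> nat * nat), monomial_rep x y u e f.
Proof.
move=> hD f0; have [s [fE us uniqs anti]] := antichain_sum_exists hD f0.
pose t0 : D * (nat * nat) := (0, (0, 0)%N).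
exists (size s), (fun i => (nth t0 s i).1), (fun i => (nth t0 s i).2); split.
- by rewrite fE (big_nth t0) big_mkord.
- by move=> i; apply: us; rewrite mem_nth.
- move=> i j ij /(dividesE _ _ hD) le.
  have ij_eq := anti _ _ (mem_nth t0 (ltn_ord i)) (mem_nth t0 (ltn_ord j)) le.
  move/eqP: ij; apply; apply/val_inj/eqP => /=.
  rewrite -(nth_uniq (0, 0)%N _ _ uniqs) ?size_map//.
  by rewrite !(nth_map t0)// ij_eq.
Qed.

(** If [e i] lies below [b] but [f] is in [box b], then [f] is in [box (e i)]. So
    are all the other terms of [f], by the antichain condition, hence also the
    term of exponent [e i], contradicting [monomial_not_box]. *)
Lemma monomial_rep_box x y n (u : 'I_n -> D) e f b :
  regular_local_ring_with [:: x; y] -> monomial_rep x y u e f ->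
  box x y b f <-> forall i, ~~ expo_le (e i) b.
Proof.
move=> hD [fE uu anti]; have [_ _ boxD boxM] := box_ideal x y b.
split=> [fb i|nle]; last first.
  by rewrite fE; apply: ideal_sum (box_ideal _ _ _) _ => i; exact: monomial_box.
apply/negP => /(box_anti) /(_ fb) {boxD boxM}.
have [_ _ boxD boxM] := box_ideal x y (e i).
move=> fi; apply: (monomial_not_box (e := e i) hD (uu i)).
have -> : u i * monomial x y (e i) =
    f + (-1) * \sum_(j | j != i) u j * monomial x y (e j).
  by rewrite fE (bigD1 i)//=; ring.
apply: (boxD) => //; apply: boxM => //.
elim/big_ind: _ => //; first by have [_ ] := box_ideal x y (e i).
move=> j ji.
apply: monomial_box; apply/negP => /(dividesE _ _ hD); exact: anti.
Qed.

End RegularPair.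

(** * The monomial valuation on the ring *)

Section MonomialValuation.
Context {R : realType} {D : idomainType} {x y : D} {r : R}.
Hypotheses (hD : regular_local_ring_with [:: x; y]) (r0 : 0 < r).
Local Notation K := {fraction D}.
Local Notation "f %:F" := (@FracField.tofrac D f).
Local Notation box := (box x y).
Implicit Types (f g : D) (e : nat * nat).

(** The real number underlying [monomial_value]. *)
Definition weight (t : R) e : R := e.1%:R + e.2%:R * t.

Lemma weightD t e e' : weight t (expo_add e e') = weight t e + weight t e'.
Proof. by rewrite /weight /= !natrD; ring. Qed.

Lemma weight_le e e' : expo_le e e' -> weight r e <= weight r e'.
Proof.
by move=> /andP[le1 le2]; rewrite lerD ?ler_nat// ler_wpM2r ?ler_nat// ltW.
Qed.

(** The chosen value is the minimum of the weights over some representation, and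
    this is also the minimum over the exponents [e] with [f] outside [box e], a
    description that mentions no representation. *)
Lemma mval_domP f : f != 0 -> exists t, [/\ mval_dom x y r f = t%:E,
  forall e, ~ box e f -> t <= weight r e & exists2 e, ~ box e f & weight r e = t].
Proof.
move=> f0; rewrite /mval_dom (negPf f0).
set V := [set v | _].
have [n [u [e [fr ->]]]] : V (xget +oo%E V).
  have [n [u [e fr]]] := monomial_rep_exists hD f0.
  by apply: (xgetPex +oo%E); eexists; exists n, u, e; split; first exact: fr.
have boxE b : ~ box b f -> exists i, expo_le (e i) b.
  move=> nb; apply: contrapT => no; apply/nb/(monomial_rep_box _ hD fr) => i.
  by apply/negP => ?; apply: no; exists i.
have nbox i : ~ box (e i) f.
  by move=> /(monomial_rep_box _ hD fr)/(_ i); rewrite /expo_le !leqnn.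
have n0 : (0 < n)%N.
  case: n u e fr {boxE nbox} => [u e [fE _ _]|//].
  by case/eqP: f0; rewrite fE big_ord0.
have [||i _ iE] := @eq_bigmin _ _ _ +oo%E (Ordinal n0) predT
    (fun i => monomial_value r (e i)) => //.
  by move=> i _; rewrite leey.
have min_le j : weight r (e i) <= weight r (e j).
  rewrite -lee_fin -[(weight r (e i))%:E]iE.
  exact: (@bigmin_le _ _ _ +oo%E j (fun i => monomial_value r (e i))).
exists (weight r (e i)); split; first exact: iE.
  by move=> b /boxE[j /weight_le]; exact: le_trans.
by exists (e i).
Qed.

Definition nu f : R := fine (mval_dom x y r f).

Lemma nuE f : f != 0 -> mval_dom x y r f = (nu f)%:E.
Proof. by move=> /mval_domP[t [tE _ _]]; rewrite /nu tE. Qed.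

Lemma nu_le f e : f != 0 -> ~ box e f -> nu f <= weight r e.
Proof. by move=> /mval_domP[t [tE le _]] /le; rewrite /nu tE. Qed.

Lemma nu_attained f : f != 0 -> exists2 e, ~ box e f & weight r e = nu f.
Proof. by move=> /mval_domP[t [tE _ [e ? ?]]]; exists e; rewrite ?/nu ?tE. Qed.

Lemma nu_unique f t : f != 0 -> (forall e, ~ box e f -> t <= weight r e) ->
  (exists2 e, ~ box e f & weight r e = t) -> nu f = t.
Proof.
move=> f0 le [e fe et]; apply/eqP; rewrite eq_le -{1}et nu_le//=.
by have [e' /le ? <-] := nu_attained f0.
Qed.

Lemma monomial_rep_nu n (u : 'I_n -> D) (e : 'I_n -> nat * nat) f : f != 0 ->
  monomial_rep x y u e f ->
  (forall i, nu f <= weight r (e i)) /\ exists i, weight r (e i) = nu f.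
Proof.
move=> f0 fr.
have lb i : nu f <= weight r (e i).
  apply: nu_le => // /(monomial_rep_box _ hD fr)/(_ i).
  by rewrite /expo_le !leqnn.
split=> //; have [b nb bE] := nu_attained f0.
apply: contrapT => no; apply/nb/(monomial_rep_box _ hD fr) => i.
apply/negP => /weight_le; rewrite bE => le; apply: no; exists i.
by apply/eqP; rewrite eq_le le lb.
Qed.

Lemma nuD f g : f != 0 -> g != 0 -> f + g != 0 ->
  Num.min (nu f) (nu g) <= nu (f + g).
Proof.
move=> f0 g0 fg0; have [e nfg <-] := nu_attained fg0.
have [fe|/(nu_le f0) le] := pselect (box e f); last by rewrite ge_min le.
have [ge|/(nu_le g0) le] := pselect (box e g); last by rewrite ge_min le orbT.
by case: nfg; have [_ _ + _] := box_ideal x y e; exact.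
Qed.

Lemma nuN f : nu (- f) = nu f.
Proof.
have [->|f0] := eqVneq f 0; first by rewrite oppr0.
have boxN e h : box e h -> box e (- h).
  by have [_ _ _ bM] := box_ideal x y e; rewrite -mulN1r; exact: bM.
apply: nu_unique; first by rewrite oppr_eq0.
  by move=> e nb; apply: nu_le => // /boxN.
have [e nb eE] := nu_attained f0; exists e => // /boxN.
by rewrite opprK.
Qed.

(** Among the exponents of minimal weight, the one with the smallest power of [x]
    plays the role of a leading term. *)
Lemma monomial_rep_lead n (u : 'I_n -> D) (e : 'I_n -> nat * nat) f : f != 0 ->
  monomial_rep x y u e f -> exists i, weight r (e i) = nu f /\
  forall j, weight r (e j) = nu f -> ((e i).1 <= (e j).1)%N.
Proof.
move=> f0 fr; have [_ [i0 /eqP i0E]] := monomial_rep_nu f0 fr.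
case: (@arg_minnP _ i0 (fun i => weight r (e i) == nu f) (fun i => (e i).1) i0E).
by move=> i /eqP iE imin; exists i; split=> // j /eqP; exact: imin.
Qed.

(** The product of the leading terms of [f] and [g] cannot be compensated: an
    exponent [e i + b j] below [e i0 + b j0] has both summands of minimal weight,
    and then the choice of the leading terms forces [i = i0] and [j = j0]. *)
Lemma nuM f g : f != 0 -> g != 0 -> nu (f * g) = nu f + nu g.
Proof.
move=> f0 g0; have fg0 : f * g != 0 by rewrite mulf_neq0.
have [n [u [e fr]]] := monomial_rep_exists hD f0.
have [m [v [b gr]]] := monomial_rep_exists hD g0.
have [le_f _] := monomial_rep_nu f0 fr; have [le_g _] := monomial_rep_nu g0 gr.
have [i0 [i0E i0min]] := monomial_rep_lead f0 fr.
have [j0 [j0E j0min]] := monomial_rep_lead g0 gr.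
have fgE : f * g = \sum_i \sum_j (u i * v j) * monomial x y (expo_add (e i) (b j)).
  case: fr gr => [fE _ _] [gE _ _]; rewrite {1}fE {1}gE mulr_suml.
  apply: eq_bigr => i _; rewrite mulr_sumr; apply: eq_bigr => j _.
  by rewrite monomialD; ring.
apply: nu_unique => // [c nc|].
  have [[i [j le]]|no] := pselect (exists i j, expo_le (expo_add (e i) (b j)) c).
    by apply: le_trans (weight_le le); rewrite weightD lerD.
  case: nc; rewrite fgE; apply: ideal_sum (box_ideal _ _ _) _ => i.
  apply: ideal_sum (box_ideal _ _ _) _ => j; apply: monomial_box.
  by apply/negP => ?; apply: no; exists i, j.
exists (expo_add (e i0) (b j0)); last by rewrite weightD i0E j0E.
set c := expo_add _ _ => cb.
have [_ box0 boxD boxM] := box_ideal x y c.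
have others i j : (i != i0) || (j != j0) -> ~~ expo_le (expo_add (e i) (b j)) c.
  move=> ij; apply/negP => le; have := weight_le le.
  rewrite !weightD i0E j0E => wle.
  have iE : weight r (e i) = nu f by have := le_f i; have := le_g j; lra.
  have jE : weight r (b j) = nu g by have := le_f i; have := le_g j; lra.
  have i1 := i0min _ iE; have j1 := j0min _ jE.
  have /andP[/= le1 le2] := le.
  have ei1 : (e i).1 = (e i0).1 by lia.
  have bj1 : (b j).1 = (b j0).1 by lia.
  have snd_eq (e1 e2 : nat * nat) : e1.1 = e2.1 -> weight r e1 = weight r e2 -> e1 = e2.
    case: e1 e2 => [p q] [p' q'] /= ->.
    rewrite /weight /= => /addrI /(mulIf (lt0r_neq0 r0)) /eqP.
    by rewrite eqr_nat => /eqP ->.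
  have ei : e i = e i0 by apply: snd_eq => //; rewrite iE.
  have bj : b j = b j0 by apply: snd_eq => //; rewrite jE.
  case/orP: ij => /eqP nij.
    case: fr => _ _ /(_ i i0); rewrite ei; apply; first exact/eqP.
    by exists 1; rewrite mul1r.
  case: gr => _ _ /(_ j j0); rewrite bj; apply; first exact/eqP.
  by exists 1; rewrite mul1r.
have uv : u i0 * v j0 \is a GRing.unit.
  by case: fr gr => _ uu _ [_ uv _]; rewrite unitrM uu uv.
apply: (monomial_not_box (e := c) hD uv).
pose rest := \sum_(j | j != j0) (u i0 * v j) * monomial x y (expo_add (e i0) (b j))
  + \sum_(i | i != i0) \sum_j (u i * v j) * monomial x y (expo_add (e i) (b j)).
have -> : u i0 * v j0 * monomial x y c = f * g + (-1) * rest.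
  by rewrite fgE (bigD1 i0)//= (bigD1 j0)//= /rest /c; ring.
apply: (boxD) => //; apply: (boxM) => //.
apply: (boxD); elim/big_ind: _ => //.
  by move=> j jj0; apply: monomial_box; rewrite others// jj0 orbT.
move=> i ii0; elim/big_ind: _ => // j _.
by apply: monomial_box; rewrite others// ii0.
Qed.

Lemma fraction_split (z : K) : exists f g : D, g != 0 /\ z = f%:F / g%:F.
Proof.
elim/quotW: z => z; exists z.1, z.2; split; first exact: denom_ratioP.
have d0 : z.2%:F != 0 by rewrite tofrac_eq0 denom_ratioP.
apply: (mulIf d0); rewrite divfK//.
have d0' := denom_ratioP z.
rewrite !piE; apply/eqmodP; rewrite /= FracField.equivfE /FracField.mulf.
by rewrite !numden_Ratio ?mulr1 ?oner_neq0// mulrC.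
Qed.

Lemma mval_frac f g : g != 0 ->
  mval x y r (f%:F / g%:F) = (mval_dom x y r f - mval_dom x y r g)%E.
Proof.
move=> g0; rewrite /mval.
set V := [set v | _].
have [f' [g' [g'0 eq_frac ->]]] : V (xget +oo%E V).
  by apply: (xgetPex +oo%E); eexists; exists f, g; split.
have gF : g%:F != 0 by rewrite tofrac_eq0.
have gF' : g'%:F != 0 by rewrite tofrac_eq0.
have {eq_frac}/eqP cross : f * g' = f' * g.
  by apply/eqP; rewrite -tofrac_eq !tofracM -eqr_div// eq_frac.
have [f0|f0] := eqVneq f 0.
  move: cross; rewrite f0 mul0r eq_sym mulf_eq0 (negPf g0) orbF => /eqP ->.
  by rewrite [mval_dom x y r 0]/mval_dom eqxx !nuE.
have f'0 : f' != 0.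
  by apply/eqP => f'0; move/eqP: cross; apply/eqP; rewrite f'0 mul0r mulf_neq0.
rewrite !nuE//; have := congr1 nu (eqP cross); rewrite !nuM// => nuE'.
by rewrite -!EFinB; congr EFin; lra.
Qed.

Lemma mval_ringE f g : g != 0 ->
  mval_ring x y r (f%:F / g%:F) <-> f = 0 \/ nu g <= nu f.
Proof.
move=> g0; rewrite /mval_ring /= mval_frac//.
have [->|f0] := eqVneq f 0.
  by rewrite [mval_dom x y r 0]/mval_dom eqxx nuE// addye// leey; split=> // _; left.
rewrite !nuE// -EFinB lee_fin subr_ge0; split=> [|[/eqP|//]]; first by right.
by rewrite (negPf f0).
Qed.

End MonomialValuation.

(** * Valuation rings of a field *)

Section ValuationRingTheory.
Context {K : fieldType}.
Implicit Types (U V W : set K) (z w : K).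

Lemma valuation_ringP V : valuation_ring V <->
  [/\ V 1, forall z w, V z -> V w -> V (z - w),
      forall z w, V z -> V w -> V (z * w) & forall z, V z \/ V z^-1].
Proof.
split=> [[[V1 VB VM] Vdich]|[V1 VB VM Vdich]].
  split=> //; first by move: V1; rewrite inE.
    by move=> z w Vz Vw; have := VB z w; rewrite !inE; exact.
  by move=> z w Vz Vw; have := VM z w; rewrite !inE; exact.
by split=> //; split=> [|z w|z w]; rewrite !inE//; [exact: VB | exact: VM].
Qed.

Lemma valuation_ring1 V : valuation_ring V -> V 1.
Proof. by case/valuation_ringP. Qed.

Lemma valuation_ring0 V : valuation_ring V -> V 0.
Proof. by case/valuation_ringP => V1 /(_ 1 1 V1 V1); rewrite subrr. Qed.

Lemma valuation_ringM V z w : valuation_ring V -> V z -> V w -> V (z * w).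
Proof. by case/valuation_ringP => _ _ + _; exact. Qed.

Lemma valuation_ringD V z w : valuation_ring V -> V z -> V w -> V (z + w).
Proof.
move=> Vr Vz Vw; rewrite -[w]opprK -[- w]sub0r.
case/valuation_ringP: (Vr) => _ VB _ _.
by apply: (VB) => //; apply: VB => //; exact: valuation_ring0.
Qed.

Lemma valuation_ringX V z n : valuation_ring V -> V z -> V (z ^+ n).
Proof.
move=> Vr Vz; elim: n => [|n IHn]; first exact: valuation_ring1.
by rewrite exprS; exact: valuation_ringM.
Qed.

Lemma valuation_ringV V z : valuation_ring V -> V z \/ V z^-1.
Proof. by case. Qed.

Lemma nonunitsP V z : valuation_ring V -> nonunits V z <-> z = 0 \/ ~ V z^-1.
Proof.
move=> Vr; split=> [[Vz nz]|[->|nz]].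
- by have [->|z0] := eqVneq z 0; [left | right => Vz'; apply: nz].
- by split; [exact: valuation_ring0 | rewrite eqxx => -[]].
- by split=> [|[_ //]]; case: (valuation_ringV z Vr).
Qed.

Lemma nonunits_anti V W : valuation_ring V -> valuation_ring W -> V `<=` W ->
  nonunits W `<=` nonunits V.
Proof.
move=> Vr Wr VW z /(nonunitsP _ Wr) H; apply/(nonunitsP _ Vr).
by case: H => [|nz]; [left | right => /VW].
Qed.

Lemma zero_prime_ideal V : valuation_ring V -> prime_ideal V [set 0].
Proof.
move=> Vr; split.
- split=> [z ->| |z w /= -> ->|c u _ /= ->]; rewrite ?addr0 ?mulr0//.
  exact: valuation_ring0.
- by move/eqP; rewrite oner_eq0.
- by move=> z w _ _ /= /eqP; rewrite mulf_eq0 => /orP[] /eqP; [left | right].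
Qed.

(** A valuation ring [W] above [V] is the localization of [V] at a prime ideal,
    namely the maximal ideal of [W]. *)
Lemma nonunits_prime_ideal V W : valuation_ring V -> valuation_ring W ->
  V `<=` W -> prime_ideal V (nonunits W).
Proof.
move=> Vr Wr VW; have nuW z := nonunitsP z Wr.
split.
- split.
  + by move=> z /(nonunits_anti Vr Wr VW)[].
  + by apply/nuW; left.
  + have key z w : nonunits W z -> nonunits W w -> w != 0 -> W (z / w) ->
        nonunits W (z + w).
      move=> _ /nuW[->|nw] w0 Wzw; first by rewrite eqxx in w0.
      apply/nuW; have [|zw0] := eqVneq (z + w) 0; [by left | right].
      move=> Wi; apply: nw.
      have -> : w^-1 = (z + w)^-1 * (1 + z / w).
        by field; rewrite w0 zw0.
      apply: valuation_ringM => //; apply: valuation_ringD => //.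
      exact: valuation_ring1.
    move=> z w nz nw.
    have [->|z0] := eqVneq z 0; first by rewrite add0r.
    have [->|w0] := eqVneq w 0; first by rewrite addr0.
    have [Wzw|] := valuation_ringV (z / w) Wr; first exact: key.
    by rewrite invf_div addrC; exact: key.
  + move=> c u Vc /nuW[->|nu]; apply/nuW; first by left; rewrite mulr0.
    have [->|u0] := eqVneq u 0; first by left; rewrite mulr0.
    have [->|c0] := eqVneq c 0; first by left; rewrite mul0r.
    right=> Wcu; apply: nu; rewrite (_ : u^-1 = c * (c * u)^-1).
      by apply: valuation_ringM => //; exact: VW.
    by field; rewrite c0 u0.
- by case/nuW => [/eqP|]; rewrite ?oner_eq0// invr1 => -[]; exact: valuation_ring1.
- move=> u v Vu Vv /nuW[/eqP|nuv].
    rewrite mulf_eq0 => /orP[] /eqP ->; [left|right]; exact/nuW/or_introl.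
  have [Wu|nu] := pselect (W u^-1); last by left; apply/nuW; right.
  right; apply/nuW; right => Wv; apply: nuv; rewrite invfM.
  exact: valuation_ringM.
Qed.

Lemma valuation_overrings_comparable U V W : valuation_ring U -> valuation_ring V ->
  valuation_ring W -> W `<=` U -> W `<=` V -> U `<=` V \/ V `<=` U.
Proof.
move=> Ur Vr Wr WU WV; have [?|nUV] := pselect (U `<=` V); [by left | right].
have [z [Uz nVz]] : exists z, U z /\ ~ V z.
  apply: contrapT => no; apply: nUV => z Uz; apply: contrapT => ?.
  by apply: no; exists z.
move=> w Vw; have [->|w0] := eqVneq w 0; first exact: valuation_ring0.
have z0 : z != 0 by apply/eqP => z0; apply: nVz; rewrite z0; exact: valuation_ring0.
have [/WV Vzw|/WU] := valuation_ringV (z / w) Wr.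
  by case: nVz; rewrite -(divfK w0 z); exact: valuation_ringM.
by rewrite invf_div => Uwz; rewrite -(divfK z0 w); exact: valuation_ringM.
Qed.

(** If [U] were strictly smaller than [V], the zero ideal, the maximal ideal of
    [V] and that of [U] would form a chain of three primes of [U]. *)
Lemma rank1_maximal U V : valuation_ring U -> valuation_ring V -> U `<=` V ->
  krull_dim U 1 -> krull_dim V 1 -> U = V.
Proof.
move=> Ur Vr UV [_ dimU] [[P [Pprime Pinc]] _].
apply/seteqP; split=> // w Vw; apply: contrapT => nUw.
have [P01 /existsNP[t /not_implyP[Pt nPt]]] := Pinc ord0 ord_max isT.
have t0 : t != 0.
  by apply/eqP => t0; apply: nPt; rewrite t0; case: (Pprime ord0) => -[].
have Vt : nonunits V t.
  apply/(nonunitsP _ Vr); right=> Vti.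
  have [[_ _ _ PM] P1 _] := Pprime ord_max; apply: P1.
  by rewrite -(mulVf t0); exact: PM.
suff : prime_chain U 2 by move/dimU.
exists (fun i => nth set0 [:: [set 0]; nonunits V; nonunits U] i); split.
  case=> [[|[|[|//]]]] _ /=.
  - exact: zero_prime_ideal.
  - exact: nonunits_prime_ideal.
  - exact: nonunits_prime_ideal.
have lt01 : [set 0] `<` nonunits V.
  split=> [z ->|/(_ t Vt)/eqP]; first by apply/(nonunitsP _ Vr); left.
  by rewrite (negPf t0).
have lt12 : nonunits V `<` nonunits U.
  split; first exact: nonunits_anti.
  have w0 : w != 0.
    by apply/eqP => w0; apply: nUw; rewrite w0; exact: valuation_ring0.
  move=> /(_ w^-1) nu.
  have /nu /(nonunitsP _ Vr) : nonunits U w^-1.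
    by apply/(nonunitsP _ Ur); right; rewrite invrK.
  by rewrite invrK; case=> // /eqP; rewrite invr_eq0 (negPf w0).
have lt02 : [set 0] `<` nonunits U.
  split=> [|sub]; first exact: subset_trans lt01.1 lt12.1.
  by apply: lt01.2; exact: subset_trans lt12.1 sub.
by case=> [[|[|[|//]]]] ? [[|[|[|//]]]] ?.
Qed.

End ValuationRingTheory.

(** * The monomial valuation on the fraction field *)

Section MonomialValuationRing.
Context {R : realType} {D : idomainType} {x y : D} {r : R}.
Hypotheses (hD : regular_local_ring_with [:: x; y]) (r0 : 0 < r).
Local Notation K := {fraction D}.
Local Notation "f %:F" := (@FracField.tofrac D f).
Local Notation nu := (@nu R D x y r).
Local Notation Vr := (mval_ring x y r).
Implicit Types (f g : D) (z w : K).

(** The real value of a nonzero fraction, with the default [0] at [z = 0]. *)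
Definition value z : R := fine (mval x y r z).

Lemma fraction_split_neq0 z : z != 0 ->
  exists f g, [/\ f != 0, g != 0 & z = f%:F / g%:F].
Proof.
move=> z0; have [f [g [g0 zE]]] := fraction_split z; exists f, g; split=> //.
by apply: contraNneq z0 => f0; rewrite zE f0 tofrac0 mul0r.
Qed.

Lemma value_frac f g : f != 0 -> g != 0 -> value (f%:F / g%:F) = nu f - nu g.
Proof. by move=> f0 g0; rewrite /value mval_frac// !nuE. Qed.

Lemma nu1 : nu 1 = 0.
Proof. by have := nuM hD r0 (oner_neq0 D) (oner_neq0 D); rewrite mulr1; lra. Qed.

Lemma value_tofrac f : f != 0 -> value f%:F = nu f.
Proof.
move=> f0; rewrite -[f%:F]divr1 -tofrac1 value_frac ?oner_neq0//.
by rewrite nu1 subr0.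
Qed.

Lemma mval_ring_value z : z != 0 -> Vr z <-> 0 <= value z.
Proof.
move=> /fraction_split_neq0[f [g [f0 g0 ->]]].
rewrite mval_ringE// value_frac// subr_ge0; split=> [[/eqP|//]|]; last by right.
by rewrite (negPf f0).
Qed.

Lemma mval_ring0 : Vr 0.
Proof. by rewrite -[0](mul0r (1%:F)^-1) -tofrac0 mval_ringE ?oner_neq0//; left. Qed.

Lemma valueM z w : z != 0 -> w != 0 -> value (z * w) = value z + value w.
Proof.
move=> /fraction_split_neq0[f [g [f0 g0 ->]]] /fraction_split_neq0[h [k [h0 k0 ->]]].
rewrite mulf_div -!tofracM !value_frac ?mulf_neq0// !nuM//; ring.
Qed.

Lemma value1 : value 1 = 0.
Proof. by rewrite -tofrac1 value_tofrac ?oner_neq0 ?nu1. Qed.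

Lemma valueV z : z != 0 -> value z^-1 = - value z.
Proof.
move=> z0; have := valueM z0 (invr_neq0 z0).
by rewrite divff// value1; lra.
Qed.

Lemma valueX z n : z != 0 -> value (z ^+ n) = n%:R * value z.
Proof.
move=> z0; elim: n => [|n IHn]; first by rewrite mul0r value1.
by rewrite exprS valueM ?expf_neq0// IHn -natr1; ring.
Qed.

Lemma valueB z w : z != 0 -> w != 0 -> z - w != 0 ->
  Num.min (value z) (value w) <= value (z - w).
Proof.
move=> /fraction_split_neq0[f [g [f0 g0 ->]]] /fraction_split_neq0[h [k [h0 k0 ->]]].
have gF : g%:F != 0 by rewrite tofrac_eq0.
have kF : k%:F != 0 by rewrite tofrac_eq0.
have -> : f%:F / g%:F - h%:F / k%:F = (f * k - h * g)%:F / (g * k)%:F.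
  by rewrite tofracB !tofracM -mulNr addf_div// mulNr.
have [fh0|fh0 _] := eqVneq (f * k - h * g) 0.
  by rewrite fh0 tofrac0 mul0r eqxx.
have := nuD hD r0 (mulf_neq0 f0 k0) _ fh0.
rewrite oppr_eq0 mulf_neq0// => /(_ isT).
rewrite !value_frac ?mulf_neq0// nuN// !nuM// !ge_min => /orP[] le.
  by apply/orP; left; lra.
by apply/orP; right; lra.
Qed.

Lemma monomial_neq0 e : monomial x y e != 0.
Proof.
rewrite mulf_neq0 ?expf_neq0 ?(parameter_neq0 hD)//.
exact: (parameter_neq0 (regular_local_sym hD)).
Qed.

Lemma value_monomial e : value (monomial x y e)%:F = weight r e.
Proof.
rewrite value_tofrac ?monomial_neq0//; apply: nu_unique => //.
  exact: monomial_neq0.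
  move=> e' nb; apply: weight_le => //; apply: contraT => nle; case: nb.
  by rewrite -[monomial _ _ _]mul1r; exact: monomial_box.
exists e => //; rewrite -[monomial _ _ _]mul1r.
by apply: monomial_not_box; rewrite ?unitr1.
Qed.

Lemma mval_ring_valuation_ring : valuation_ring Vr.
Proof.
apply/valuation_ringP; split.
- by apply/mval_ring_value; rewrite ?oner_neq0// value1.
- move=> z w Vz Vw; have [->|zw0] := eqVneq (z - w) 0; first exact: mval_ring0.
  have [z0|z0] := eqVneq z 0.
    rewrite z0 sub0r; have [->|w0] := eqVneq w 0; first by rewrite oppr0 -z0.
    move: Vw; rewrite !mval_ring_value ?oppr_eq0// -mulN1r.
    have N1 : (-1 : K) != 0 by rewrite oppr_eq0 oner_neq0.
    rewrite valueM//; have := valueM N1 N1; rewrite mulrNN mulr1 value1; lra.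
  have [->|w0] := eqVneq w 0; first by rewrite subr0.
  apply/mval_ring_value => //; apply: le_trans (valueB z0 w0 zw0).
  by rewrite le_min; apply/andP; split; apply/mval_ring_value.
- move=> z w Vz Vw; have [->|z0] := eqVneq z 0.
    by rewrite mul0r; exact: mval_ring0.
  have [->|w0] := eqVneq w 0; first by rewrite mulr0; exact: mval_ring0.
  apply/mval_ring_value; first by rewrite mulf_neq0.
  by rewrite valueM// addr_ge0//; apply/mval_ring_value.
- move=> z; have [->|z0] := eqVneq z 0; first by left; exact: mval_ring0.
  have [le|/ltW le] := leP 0 (value z); [left | right].
    exact/mval_ring_value.
  by apply/mval_ring_value; rewrite ?invr_eq0// valueV// oppr_ge0.
Qed.

Lemma mval_ring_base f : Vr f%:F.
Proof.
have [->|f0] := eqVneq f 0; first by rewrite tofrac0; exact: mval_ring0.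
apply/mval_ring_value; first by rewrite tofrac_eq0.
rewrite value_tofrac//; have [e _ <-] := nu_attained hD r0 f0.
by rewrite addr_ge0// mulr_ge0// ltW.
Qed.

Lemma nonunits_value z : z != 0 -> nonunits Vr z <-> 0 < value z.
Proof.
move=> z0; rewrite (nonunitsP _ mval_ring_valuation_ring).
split=> [[/eqP|nV]|v0]; first by rewrite (negPf z0).
  rewrite ltNge; apply/negP => le; apply: nV.
  by apply/mval_ring_value; rewrite ?invr_eq0// valueV// oppr_ge0.
right=> /mval_ring_value; rewrite invr_eq0 valueV// => /(_ z0); lra.
Qed.

Lemma x_value : value x%:F = 1.
Proof.
have := value_monomial (1, 0)%N.
by rewrite monomialE expr1 expr0 mulr1 /weight /= mul0r addr0.
Qed.

Lemma x_neq0 : x%:F != 0.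
Proof. by rewrite tofrac_eq0 (parameter_neq0 hD). Qed.

(** The value group is archimedean: any element of positive value has a power
    whose value exceeds that of a given nonzero element of [P]. *)
Lemma mval_ring_prime P : prime_ideal Vr P -> P = [set 0] \/ P = nonunits Vr.
Proof.
move=> [[P_sub P0 PD PM] P1 Pprime].
have [[z [Pz z0]]|no] := pselect (exists z, P z /\ z != 0); [right | left]; last first.
  apply/seteqP; split=> [z Pz|z ->//]; apply: contrapT => /eqP z0.
  by apply: no; exists z.
have Vpow w n : P (w ^+ n) -> Vr w -> P w.
  move=> + Vw; elim: n => [//|n IHn]; rewrite exprS.
  case/(Pprime w (w ^+ n) Vw) => //.
  exact: valuation_ringX mval_ring_valuation_ring Vw.
apply/seteqP; split=> w.
  move=> Pw; apply/(nonunitsP _ mval_ring_valuation_ring).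
  have [->|w0] := eqVneq w 0; [by left | right=> Vw; apply: P1].
  by rewrite -(mulVf w0); exact: PM.
move=> nw; have [->//|w0] := eqVneq w 0.
have w_pos : 0 < value w by apply/nonunits_value.
have Vw : Vr w by case: nw.
have z_pos : 0 <= value z by apply/(mval_ring_value z0)/P_sub.
pose n := Num.bound (value z / value w).
have n_big : value z < n%:R * value w.
  by rewrite -ltr_pdivrMr// archi_boundP// divr_ge0// ltW.
apply: (Vpow w n) => //; rewrite -(divfK z0 (w ^+ n)); apply: PM => //.
apply/mval_ring_value; first by rewrite mulf_neq0 ?expf_neq0 ?invr_eq0.
by rewrite valueM ?expf_neq0 ?invr_eq0// valueV// valueX// subr_ge0 ltW.
Qed.

Lemma mval_ring_krull_dim : krull_dim Vr 1.
Proof.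
have nux : nonunits Vr x%:F by apply/(nonunits_value x_neq0); rewrite x_value.
have vV := mval_ring_valuation_ring; split.
  exists (fun i => nth set0 [:: [set 0]; nonunits Vr] i); split.
    case=> [[|[|//]]] _ /=; first exact: zero_prime_ideal.
    exact: nonunits_prime_ideal.
  case=> [[|[|//]]] ? [[|[|//]]] ? //= _; split=> [z ->|/(_ _ nux)/eqP].
    by apply/(nonunitsP _ vV); left.
  by rewrite (negPf x_neq0).
move=> m [P [Pprime Pinc]]; rewrite leqNgt; apply/negP => m2.
pose i1 : 'I_m.+1 := Ordinal (leq_trans m2 (leqnSn m)).
have pos (i : 'I_m.+1) : (0 < i)%N -> P i = nonunits Vr.
  move=> i0; case: (mval_ring_prime (Pprime i)) => // Pi0.
  have [_ []] := Pinc ord0 i i0.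
  by rewrite Pi0 => z ->; case: (Pprime ord0) => -[].
have [_ []] := Pinc i1 ord_max m2.
by rewrite !pos// (ltn_trans _ m2).
Qed.

End MonomialValuationRing.

(** * The slope of a valuation overring of the interval ring *)

Lemma ratio_between (R : realType) (s t : R) : 0 <= s -> s < t ->
  exists p q : nat, [/\ (0 < q)%N, s * q%:R < p%:R & p%:R < t * q%:R].
Proof.
move=> s0 st; pose q := Num.bound (t - s)^-1.
have q_big : 1 < (t - s) * q%:R.
  by rewrite mulrC -ltr_pdivrMr ?subr_gt0// mul1r archi_boundP// invr_ge0 subr_ge0 ltW.
have q0 : (0 < q)%N.
  by rewrite lt0n; apply: contraTneq q_big => ->; rewrite mulr0 ltNge ler01.
exists (Num.truncn (s * q%:R)).+1, q; split=> //.
  by case/andP: (truncn_itv (mulr_ge0 s0 (ler0n _ q))).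
have /andP[+ _] := truncn_itv (mulr_ge0 s0 (ler0n _ q)).
rewrite -natr1; lra.
Qed.

(** Used for the order on monomials given by a valuation ring [W], which is only
    a total preorder. *)
Lemma total_preorder_min (I : eqType) (rel : I -> I -> Prop) (i : I) (s : seq I) :
  (forall j k, rel j k \/ rel k j) ->
  (forall j k l, rel j k -> rel k l -> rel j l) ->
  exists j, forall k, k \in i :: s -> rel j k.
Proof.
move=> tot trans; elim: s i => [|i' s IHs] i.
  by exists i => k; rewrite inE => /eqP ->; case: (tot i i).
have [j jmin] := IHs i'.
have [ij|ji] := tot i j; [exists i | exists j] => k;
  rewrite inE => /orP[/eqP ->//|/jmin].
- by case: (tot i i).
- exact: trans.
- by [].
Qed.

(** The cancellation that ends the proof of [overring_sub_mval_ring]. *)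
Lemma telescoping_quotient (F : fieldType) (X E A B C : F) :
  X != 0 -> E != 0 -> A != 0 -> B != 0 -> C != 0 ->
  (E * X) / A * (A / B) * ((B / C) * (C / (E * X ^+ 2))) = X^-1.
Proof. by move=> X0 E0 A0 B0 C0; field; rewrite X0 E0 A0 B0 C0. Qed.

Section IntervalRing.
Context {R : realType} {D : idomainType} {x y : D} {a b : R}.
Hypotheses (hD : regular_local_ring_with [:: x; y]) (a0 : 0 < a).
Local Notation K := {fraction D}.
Local Notation "f %:F" := (@FracField.tofrac D f).
Local Notation value r z := (@value R D x y r z).
Local Notation nu r f := (@nu R D x y r f).
Local Notation T := (interval_ring x y a b).
Local Notation mon e := ((monomial x y e)%:F).
Implicit Types (f g : D) (z : K) (r s t : R).

Lemma mon_neq0 e : mon e != 0.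
Proof. by rewrite tofrac_eq0 monomial_neq0. Qed.

Lemma monD e e' : mon (expo_add e e') = mon e * mon e'.
Proof. by rewrite monomialD tofracM. Qed.

Lemma monX e n : mon e ^+ n = mon (n * e.1, n * e.2)%N.
Proof.
by rewrite -tofracXn; congr tofrac; rewrite /monomial exprMn -!exprM !(mulnC n).
Qed.

Lemma value_mon_ratio r e e' : 0 < r ->
  value r (mon e' / mon e) = weight r e' - weight r e.
Proof.
move=> r0; rewrite valueM ?invr_eq0 ?mon_neq0// valueV ?mon_neq0//.
by rewrite !value_monomial.
Qed.

(** A valuation ring inside [mval_ring t] cannot contain the inverse of an element
    that is positive at [t], so it contains the element. *)
Lemma interval_ring_pos z : z != 0 ->
  (forall t, a <= t <= b -> 0 < value t z) -> T z.
Proof.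
move=> z0 zpos V Vr VD [t]; rewrite in_itv /= => tab VVt.
have t0 : 0 < t by case/andP: tab => at_ _; exact: lt_le_trans at_.
have [//|/VVt] := valuation_ringV z Vr.
have zi0 : z^-1 != 0 by rewrite invr_eq0.
move=> /(mval_ring_value hD t0 zi0); rewrite valueV//.
by have := zpos _ tab; lra.
Qed.

Lemma interval_ring_base f : T f%:F.
Proof. by move=> V _ VD _. Qed.

Lemma interval_ring_mon e e' :
  (forall t, a <= t <= b -> weight t e < weight t e') -> T (mon e' / mon e).
Proof.
move=> lt; apply: interval_ring_pos; first by rewrite mulf_neq0 ?invr_eq0 ?mon_neq0.
move=> t tab; rewrite value_mon_ratio; first by have := lt _ tab; lra.
by case/andP: tab => at_ _; exact: lt_le_trans at_.
Qed.

Lemma mval_ring_val_overring r : a <= r <= b -> val_overrings x y a b (mval_ring x y r).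
Proof.
move=> rab; have r0 : 0 < r by case/andP: rab => ar _; exact: lt_le_trans ar.
have vV := mval_ring_valuation_ring hD r0.
split=> //.
  move=> z; apply=> //; first exact: mval_ring_base.
  by exists r; rewrite ?in_itv.
move=> VT; have : nonunits (mval_ring x y r) x%:F.
  by apply/nonunits_value; rewrite ?x_value// (x_neq0 hD).
by case/(nonunitsP _ vV) => [/eqP|]; [rewrite (negPf (x_neq0 hD)) | apply; rewrite VT].
Qed.

Section Overring.
Context {W : set K}.
Hypothesis (WX : val_overrings x y a b W).

Let Wr : valuation_ring W. Proof. by case: WX. Qed.
Let TW : T `<=` W. Proof. by case: WX. Qed.

Lemma overring_base f : W f%:F.
Proof. by apply: TW; exact: interval_ring_base. Qed.

(** For nonzero [g] in [D], the values of [g] are bounded on the interval, so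
    [x ^+ N / g] is in the interval ring for large [N]. If [W] contained the
    inverse of [x], it would contain that of every such [g], and be the whole
    field. *)
Lemma overring_x : ~ W (x%:F)^-1.
Proof.
move=> Wx; case: WX => _ _; apply; apply/seteqP; split=> // z _.
have [f [g [g0 ->]]] := fraction_split z.
apply: valuation_ringM => //; first exact: overring_base.
have [e ne _] := nu_attained hD a0 g0.
pose N := Num.bound (weight b e).
have gF : g%:F != 0 by rewrite tofrac_eq0.
have xF := x_neq0 hD.
have : T (x%:F ^+ N / g%:F).
  apply: interval_ring_pos => [|t /andP[at_ tb]].
    by rewrite mulf_neq0 ?expf_neq0 ?invr_eq0.
  have t0 : 0 < t := lt_le_trans a0 at_.
  rewrite valueM ?expf_neq0 ?invr_eq0// valueV// valueX// x_value// value_tofrac//.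
  have := nu_le hD t0 g0 ne.
  have : weight b e < N%:R.
    by rewrite archi_boundP// addr_ge0// mulr_ge0// (le_trans (ltW t0)).
  have : weight t e <= weight b e by rewrite lerD2l ler_wpM2l.
  lra.
move=> /TW WN; rewrite -(mulKf (expf_neq0 N xF) (g%:F)^-1) -exprVn.
by apply: valuation_ringM => //; exact: valuation_ringX.
Qed.

(** When $w$ is a valuation with ring [W], these are the fractions $p/q$ with
    $w(y^q) \ge w(x^p)$; their supremum is the ratio $w(y) / w(x)$, which exists
    as a real number because $w(x)$ and $w(y)$ are positive and archimedean
    equivalent. *)
Definition slopes : set R :=
  [set s | exists p q : nat,
    [/\ (0 < q)%N, s * q%:R = p%:R & W (mon (0, q)%N / mon (p, 0)%N)]].

Definition slope : R := sup slopes.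

Lemma overring_ratio_dich e e' : W (mon e / mon e') \/ W (mon e' / mon e).
Proof. by have := valuation_ringV (mon e / mon e') Wr; rewrite invf_div. Qed.

Lemma overring_xN n : (0 < n)%N -> ~ W (x%:F ^- n).
Proof.
case: n => // n _ Wn; apply: overring_x.
have xF := x_neq0 hD.
rewrite -(mulKf (expf_neq0 n xF) (x%:F)^-1) mulrCA -invfM -exprSr.
by apply: valuation_ringM => //; apply: valuation_ringX => //; exact: overring_base.
Qed.

Lemma ratio_trans e1 e2 e3 :
  W (mon e1 / mon e2) -> W (mon e2 / mon e3) -> W (mon e1 / mon e3).
Proof.
move=> W12 W23; rewrite -(divfK (mon_neq0 e2) (mon e1)) -(mulrA (mon e1 / mon e2)).
exact: (valuation_ringM Wr W12 W23).
Qed.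

Lemma ratio_pow n e1 e2 : W (mon e1 / mon e2) ->
  W (mon (n * e1.1, n * e1.2)%N / mon (n * e2.1, n * e2.2)%N).
Proof. by move=> /(valuation_ringX n Wr); rewrite expr_div_n !monX. Qed.

Lemma ratio_cancel e e1 e2 : W (mon (expo_add e e1) / mon (expo_add e e2)) <->
  W (mon e1 / mon e2).
Proof. by rewrite !monD -mulf_div divff ?mon_neq0// mul1r. Qed.

Lemma ratio_x_drop n p q : (0 < n)%N ->
  ~ W (mon (p, q)%N / mon (n + p, q)%N).
Proof.
move=> n0; rewrite (_ : (n + p, q)%N = expo_add (p, q)%N (n, 0)%N); last first.
  by rewrite /expo_add /= addnC addn0.
rewrite [in X in ~ X]monD invfM mulrA divff ?mon_neq0// mul1r.
by rewrite monomialE mulr1 tofracXn; exact: overring_xN.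
Qed.

Lemma mon00 : mon (0, 0)%N = 1.
Proof. by rewrite monomialE !expr0 mulr1 tofrac1. Qed.

Lemma slopes0 : slopes 0.
Proof.
exists 0%N, 1%N; rewrite mul0r mon00 divr1; split=> //; exact: overring_base.
Qed.

(** If $y^q/x^p$ were in [W] with $p/q > b$, then so would be its [n]-th power,
    while $x^{np-1}/y^{nq}$ lies in the interval ring for large [n]. The product
    is the inverse of [x]. *)
Lemma slopes_ub : ubound slopes b.
Proof.
move=> s [p [q [q0 sq Wyx]]]; rewrite leNgt; apply/negP => bs.
have bqp : 0 < p%:R - b * q%:R by rewrite -sq -mulrBl mulr_gt0 ?ltr0n ?subr_gt0.
pose n := Num.bound (p%:R - b * q%:R)^-1.
have n_big : 1 < (p%:R - b * q%:R) * n%:R.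
  by rewrite mulrC -ltr_pdivrMr// mul1r archi_boundP// invr_ge0 ltW.
have /TW Wxy : T (mon (n * p, 0)%N / mon (1, n * q)%N).
  apply: interval_ring_mon => t /andP[_ tb]; rewrite /weight /= !natrM mul0r addr0.
  have : n%:R * q%:R * t <= n%:R * q%:R * b by rewrite ler_wpM2l.
  by lra.
have := ratio_pow n Wyx; rewrite /= !muln0 => Wyx'.
exact: (@ratio_x_drop 1 0 (n * q)%N isT (ratio_trans Wyx' Wxy)).
Qed.

Lemma slopes_le s : slopes s -> s <= slope.
Proof. by move=> Ss; apply: ub_le_sup => //; exists b; exact: slopes_ub. Qed.

Lemma slope_ge0 : 0 <= slope. Proof. exact/slopes_le/slopes0. Qed.

Lemma slope_itv : a <= slope <= b.
Proof.
apply/andP; split; last first.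
  by apply: ge_sup; [exists 0; exact: slopes0 | exact: slopes_ub].
rewrite leNgt; apply/negP => /(ratio_between slope_ge0)[p [q [q0 qp pq]]].
have qR : 0 < q%:R :> R by rewrite ltr0n.
have : slopes (p%:R / q%:R).
  exists p, q; split=> //; first by rewrite divfK// gt_eqF.
  apply: TW; apply: interval_ring_mon => t /andP[at_ _]; rewrite /weight /=.
  have : a * q%:R <= q%:R * t by rewrite mulrC ler_wpM2l.
  by lra.
by move=> /slopes_le; rewrite ler_pdivrMr//; lra.
Qed.

Lemma ratio_below_slope p q : p%:R < slope * q%:R -> W (mon (0, q)%N / mon (p, 0)%N).
Proof.
move=> pq; have [//|Wxy] := overring_ratio_dich (0, q)%N (p, 0)%N.
have qR : 0 < q%:R :> R.
  by rewrite ltr0n lt0n; apply: contraTneq pq => ->; rewrite mulr0 ltNge ler0n.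
have [||s [p1 [q1 [q10 sq1 Wyx]]] ps] := @sup_gt _ slopes (p%:R / q%:R).
- by exists 0; exact: slopes0.
- by rewrite ltr_pdivrMr.
have lt : (q1 * p < q * p1)%N.
  rewrite -(ltr_nat R) !natrM -sq1.
  have q1R : 0 < q1%:R :> R by rewrite ltr0n.
  have : p%:R < s * q%:R by rewrite -ltr_pdivrMr.
  by rewrite -(ltr_pM2l q1R p%:R (s * _)); lra.
have Wxy' := ratio_pow q1 Wxy; have Wyx' := ratio_pow q Wyx.
rewrite /= !muln0 in Wxy' Wyx'; rewrite (mulnC q q1) in Wyx'.
have := ratio_trans Wxy' Wyx'.
rewrite -(subnK (ltnW lt)) => /(@ratio_x_drop _ _ _ _)[]//.
by rewrite subn_gt0.
Qed.

Lemma ratio_above_slope p q : slope * q%:R < p%:R -> W (mon (p, 0)%N / mon (0, q)%N).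
Proof.
case: (posnP q) => [-> _|q0 qp]; first by rewrite mon00 divr1; exact: overring_base.
have [//|Wyx] := overring_ratio_dich (p, 0)%N (0, q)%N.
have qR : 0 < q%:R :> R by rewrite ltr0n.
have : slopes (p%:R / q%:R) by exists p, q; split=> //; rewrite divfK// gt_eqF.
by move=> /slopes_le; rewrite ler_pdivrMr//; lra.
Qed.

(** After cancelling the common monomial, only a fraction $y^j/x^i$ or $x^i/y^j$
    remains, to be compared with the slope. *)
Lemma ratio_weight e e' : weight slope e < weight slope e' -> W (mon e' / mon e).
Proof.
case: e e' => [p q] [p' q']; rewrite /weight /= => lt.
have := slope_ge0 => s0.
have [qq'|q'q] := leqP q q'.
  have [pp'|p'p] := leqP p p'.
    rewrite (_ : (p', q') = expo_add (p, q) (p' - p, q' - q)%N); last first.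
      by rewrite /expo_add /= !subnKC.
    by rewrite monD mulrC mulKf ?mon_neq0//; exact: overring_base.
  rewrite (_ : (p', q') = expo_add (p', q) (0, q' - q)%N); last first.
    by rewrite /expo_add /= addn0 subnKC.
  rewrite [X in _ / mon X](_ : _ = expo_add (p', q) (p - p', 0)%N); last first.
    by rewrite /expo_add /= addn0 subnKC// ltnW.
  apply/ratio_cancel/ratio_below_slope; rewrite !natrB ?(ltnW p'p)//.
  by lra.
have pp' : (p <= p')%N.
  rewrite leqNgt; apply/negP => p'p.
  have : p'%:R <= p%:R :> R by rewrite ler_nat ltnW.
  have : q'%:R * slope <= q%:R * slope by rewrite ler_wpM2r// ler_nat ltnW.
  by lra.
rewrite (_ : (p', q') = expo_add (p, q') (p' - p, 0)%N); last first.
  by rewrite /expo_add /= addn0 subnKC.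
rewrite [X in _ / mon X](_ : _ = expo_add (p, q') (0, q - q')%N); last first.
  by rewrite /expo_add /= addn0 subnKC// ltnW.
apply/ratio_cancel/ratio_above_slope; rewrite !natrB ?(ltnW q'q)//.
by lra.
Qed.

(** [e] is an exponent of [g] that is minimal for the order that [W] induces on
    monomials. *)
Lemma overring_lead_monomial g : g != 0 ->
  exists e, W (g%:F / mon e) /\ nu slope g <= weight slope e.
Proof.
have s0 : 0 < slope by case/andP: slope_itv => /(lt_le_trans a0).
move=> g0; have [n [u [e gr]]] := monomial_rep_exists hD g0.
have [le _] := monomial_rep_nu hD s0 g0 gr.
have [gE _ _] := gr.
case: n u e gr le gE => [|n] u e _ le gE.
  by case/eqP: g0; rewrite gE big_ord0.
have [||j jmin] := @total_preorder_min _ (fun j k => W (mon (e k) / mon (e j)))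
    ord0 (enum 'I_n.+1).
- by move=> j k; exact: overring_ratio_dich.
- by move=> j k l Wkj Wlk; exact: ratio_trans Wlk Wkj.
exists (e j); split=> //.
rewrite gE rmorph_sum mulr_suml /=; elim/big_ind: _ => [|z w Wz Wv|k _].
- exact: valuation_ring0.
- exact: valuation_ringD.
rewrite tofracM -mulrA; apply: valuation_ringM => //; first exact: overring_base.
by apply: jmin; rewrite inE mem_enum orbT.
Qed.

(** The valuation of [W] could a priori exceed the minimum over the monomials of
    [f]; the interval ring prevents this. If the monomial $x^{e_1}y^{e_2}$ of [f]
    has minimal weight at the slope, it still bounds the value of [f] at every
    other point of the interval, so that $(x^{e_1}y^{e_2})^N x / f^N$ has positive
    values throughout and lies in [W] for all [N]. Now suppose that [f / g] is in
    [W] with [f] of smaller value than [g]; for large [N], multiplying by fractions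
    known to be in [W] gives the inverse of [x]. *)
Lemma overring_sub_mval_ring : W `<=` mval_ring x y slope.
Proof.
have s0 : 0 < slope by case/andP: slope_itv => /(lt_le_trans a0).
move=> z Wz; have [->|z0] := eqVneq z 0; first exact: mval_ring0.
apply/(mval_ring_value hD s0 z0); rewrite leNgt; apply/negP.
have [f [g [f0 g0 zE]]] := fraction_split_neq0 z0.
rewrite zE value_frac// subr_lt0 => fg.
have [e' [Wg ge']] := overring_lead_monomial g0.
have [n [u [b' fr]]] := monomial_rep_exists hD f0.
have [_ [i iE]] := monomial_rep_nu hD s0 f0 fr.
set e := b' i in iE.
have fF : f%:F != 0 by rewrite tofrac_eq0.
have gF : g%:F != 0 by rewrite tofrac_eq0.
have gap : 0 < weight slope e' - weight slope e by lra.
(* The gap 2 leaves room for the monomial x^2, one factor x more than in W2. *)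
pose N := Num.bound (2 / (weight slope e' - weight slope e)).
have N_big : 2 < N%:R * (weight slope e' - weight slope e).
  by rewrite -ltr_pdivrMr// archi_boundP// divr_ge0// ltW.
pose eN := (N * e.1, N * e.2)%N; pose eN' := (N * e'.1, N * e'.2)%N.
have weightX t (c : nat * nat) : weight t (N * c.1, N * c.2)%N = N%:R * weight t c.
  by rewrite /weight /= !natrM; ring.
have W1 : W (mon eN' / mon (expo_add eN (2, 0)%N)).
  apply: ratio_weight; rewrite weightD !weightX {2}/weight /= mul0r addr0; lra.
have W2 : W (mon (expo_add eN (1, 0)%N) / f%:F ^+ N).
  apply: TW; apply: interval_ring_pos => [|t /andP[at_ _]].
    by rewrite mulf_neq0 ?mon_neq0 ?invr_eq0 ?expf_neq0.
  have t0 : 0 < t := lt_le_trans a0 at_.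
  rewrite valueM ?mon_neq0 ?invr_eq0 ?expf_neq0// valueV ?expf_neq0// valueX//.
  rewrite value_monomial// value_tofrac// weightD weightX {2}/weight /= mul0r addr0.
  have [/(_ i) le _] := monomial_rep_nu hD t0 f0 fr.
  have : N%:R * nu t f <= N%:R * weight t e by rewrite ler_wpM2l.
  by lra.
have W3 := valuation_ringX N Wr Wz; have W4 := valuation_ringX N Wr Wg.
apply: overring_x.
have := valuation_ringM Wr (valuation_ringM Wr W2 W3) (valuation_ringM Wr W4 W1).
rewrite zE !expr_div_n monX !monD (monomialE _ _ 1 0) (monomialE _ _ 2 0) !expr0 !mulr1.
by rewrite expr1 tofracXn telescoping_quotient ?mon_neq0 ?expf_neq0 ?(x_neq0 hD).
Qed.

Lemma rank1_overringE U : rank1_overrings W U <-> U = mval_ring x y slope.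
Proof.
have s0 : 0 < slope by case/andP: slope_itv => /(lt_le_trans a0).
have vS := mval_ring_valuation_ring hD s0; have dS := mval_ring_krull_dim hD s0.
split=> [[Ur WU dU]|->]; last by split=> //; exact: overring_sub_mval_ring.
have [US|SU] := valuation_overrings_comparable Ur vS Wr WU overring_sub_mval_ring.
  exact: rank1_maximal.
exact/esym/rank1_maximal.
Qed.

End Overring.

Lemma value_slope_ratio t p q : 0 < t ->
  value t (mon (0, q)%N / mon (p, 0)%N) = q%:R * t - p%:R.
Proof. by move=> t0; rewrite value_mon_ratio// /weight /= mul0r add0r addr0. Qed.

Lemma mval_ring_slope t p q : 0 < t ->
  mval_ring x y t (mon (0, q)%N / mon (p, 0)%N) <-> p%:R <= q%:R * t.
Proof.
move=> t0; rewrite (mval_ring_value hD t0) ?value_slope_ratio ?subr_ge0//.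
by rewrite mulf_neq0 ?mon_neq0 ?invr_eq0 ?mon_neq0.
Qed.

Lemma mval_ring_inj s t : 0 < s -> 0 < t ->
  mval_ring x y s = mval_ring x y t -> s = t.
Proof.
wlog st : s t / s < t => [wlog s0 t0 st|s0 t0 eqV].
  have [lt|lt|//] := ltgtP s t; first exact: wlog.
  exact/esym/wlog.
have [p [q [q0 sq qt]]] := ratio_between (ltW s0) st.
have : mval_ring x y t (mon (0, q)%N / mon (p, 0)%N).
  by apply/mval_ring_slope => //; rewrite mulrC ltW.
by rewrite -eqV => /mval_ring_slope => /(_ s0); lra.
Qed.

End IntervalRing.

(** * The two topologies *)

Section SpaceOfOverrings.
Context {R : realType} {D : idomainType} {x y : D} {a b : R}.
Hypotheses (hD : regular_local_ring_with [:: x; y]) (a0 : 0 < a).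
Local Notation K := {fraction D}.
Local Notation "f %:F" := (@FracField.tofrac D f).
Local Notation X := (spaceX x y a b).
Local Notation patchX := (patchX x y a b).
Local Notation zariskiX := (zariskiX x y a b).
Local Notation I := (`[a, b]%classic : set R).
Local Notation mon e := ((monomial x y e)%:F).

Lemma spaceX_val_overrings (W : X) : val_overrings x y a b (val W).
Proof. exact: set_mem (valP W). Qed.

Lemma zariski_open_mem (z : K) : open ([set V | val V z] : set zariskiX).
Proof.
exists [set [set z]]; first by move=> _ ->; exact: finite_set1.
by rewrite bigcup_set1; apply/seteqP; split=> [V Vz|V Vz _ ->]; [exact: Vz | exact: Vz].
Qed.

Lemma patch_open_zariski (A : set X) : open (A : set zariskiX) -> open (A : set patchX).
Proof.
case=> Fs Fs_fin <-.
exists [set FG | Fs FG.1 /\ FG.2 = set0].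
  by move=> [F G] /= [/Fs_fin Ff ->]; split=> //=; exact: finite_set0.
apply/seteqP; split=> V.
  by case=> -[F G] /= [FsF _] [FV _]; exists F.
by case=> F FsF FV; exists (F, set0) => //; split=> //=; exact: sub0set.
Qed.

(** The point of the interval attached to a member of the space. *)
Definition slopeX (W : X) : R := slope (x := x) (y := y) (W := val W).

Lemma slopeX_itv W : I (slopeX W).
Proof.
by rewrite /= in_itv /=; exact: (slope_itv hD a0 (spaceX_val_overrings W)).
Qed.


Lemma slopeX_rank1 (W : X) U :
  rank1_overrings (val W) U <-> U = mval_ring x y (slopeX W).
Proof. exact: (rank1_overringE hD a0 (spaceX_val_overrings W)). Qed.

(** If $p/q$ lies strictly between a bound $c$ and the slope of [W], then [W]
    contains $y^q/x^p$; conversely, all members of the space that contain this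
    element, which form a Zariski open set, have slope at least $p/q$, hence
    above $c$. Upper bounds are obtained in the same way from $x^p/y^q$. *)
Lemma slopeX_continuous : continuous (slopeX : zariskiX -> R).
Proof.
move=> W; have WX := spaceX_val_overrings W.
have nbhsW : Filter (nbhs (W : zariskiX)) := nbhs_filter (W : zariskiX).
apply/cvgrPdist_lt => e e0.
have s0 (V : X) : 0 < slopeX V.
  by have := slopeX_itv V; rewrite /= in_itv /= => /andP[/(lt_le_trans a0)].
have sub (V : X) := overring_sub_mval_ring hD a0 (spaceX_val_overrings V).
have lower : nbhs W [set V : zariskiX | slopeX W - e < slopeX V].
  have [||p [q [q0 cp pW]]] := @ratio_between R (Num.max 0 (slopeX W - e)) (slopeX W).
  - by rewrite le_max lexx.
  - by rewrite gt_max s0 ltrBlDr ltrDl e0.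
  have qR : 0 < q%:R :> R by rewrite ltr0n.
  have Wz := ratio_below_slope hD a0 WX pW.
  apply: (filterS _ (open_nbhs_nbhs (conj (zariski_open_mem _) Wz))) => V /sub.
  move=> /(mval_ring_slope hD p q (s0 V)) pV.
  have : (slopeX W - e) * q%:R <= Num.max 0 (slopeX W - e) * q%:R.
    by rewrite ler_wpM2r// le_max lexx orbT.
  move=> le; rewrite /= -(ltr_pM2r qR); rewrite mulrC in pV.
  exact: le_lt_trans le (lt_le_trans cp pV).
have upper : nbhs W [set V : zariskiX | slopeX V < slopeX W + e].
  have [||p [q [q0 Wp pc]]] := @ratio_between R (slopeX W) (slopeX W + e).
  - exact: ltW.
  - by rewrite ltrDl.
  have qR : 0 < q%:R :> R by rewrite ltr0n.
  have Wz := ratio_above_slope hD a0 WX Wp.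
  apply: (filterS _ (open_nbhs_nbhs (conj (zariski_open_mem _) Wz))) => V /sub.
  move=> /(mval_ring_value hD (s0 V)).
  rewrite mulf_neq0 ?invr_eq0 ?mon_neq0// => /(_ isT).
  rewrite value_mon_ratio// /weight /= mul0r add0r addr0 => pV.
  by rewrite -(ltr_pM2r qR); lra.
near=> V; rewrite distrC ltr_distl; apply/andP; split; near: V.
  exact: lower.
exact: upper.
Unshelve. all: by end_near.
Qed.

Lemma filter_forall_finite (T : Type) (J : choiceType) (F : set_system T)
    (A : set J) (P : J -> set T) :
  Filter F -> finite_set A -> (forall j, A j -> F (P j)) ->
  F [set t | forall j, A j -> P j t].
Proof.
move=> FF /finite_fsetP[B ->] FP.
by apply: filterS (filter_bigI FF FP) => t Pt j /Pt.
Qed.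

(** The elements that belong to almost all members of an ultrafilter form a
    valuation ring, which is the limit. It is again different from the whole
    field because the inverse of [x] belongs to no member of the space. *)
Lemma patchX_compact : compact [set: patchX].
Proof.
rewrite compact_ultra => F FU _.
pose L : set K := [set z | F [set V : patchX | val V z]].
have FF : Filter F by exact: filter_filter.
have XP (V : X) := spaceX_val_overrings V.
have XV (V : X) : valuation_ring (val V) by case: (XP V).
have LX : val_overrings x y a b L.
  split.
  - apply/valuation_ringP; split.
    + by apply: filterE => V; exact: valuation_ring1.
    + move=> z w; apply: filterS2 => V.
      by case/valuation_ringP: (XV V) => _ + _ _; exact.
    + by move=> z w; apply: filterS2 => V; exact: valuation_ringM.
    + move=> z; have [|nz] := in_ultra_setVsetC [set V : patchX | val V z] FU.
        by left.
      right; apply: filterS nz => V nz.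
      by case: (valuation_ringV z (XV V)).
  - by move=> z Tz; apply: filterE => V; case: (XP V) => _ + _; exact.
  - move=> LT; have : L (x%:F)^-1 by rewrite LT.
    move=> /filter_ex[V]; exact: overring_x (XP V).
pose W : patchX := SigSub (mem_set LX).
exists W; split=> // A; rewrite nbhsE => -[B [[Fs Fs_fin <-] [[G H] FGH [WG WH]]] BA].
have [Gfin Hfin] := Fs_fin _ FGH.
suff : F (patch_basic (G, H)).
  by apply: filterS => V VGH; apply: BA; exists (G, H).
apply: filterI; apply: filter_forall_finite => // z.
move=> /WH; rewrite nonunitsP; last by case: (LX).
case=> [->|nz].
  by apply: filterE => V; apply/nonunitsP; [exact: XV | left].
have [//|] := in_ultra_setVsetC [set V : patchX | val V z^-1] FU.
by apply: filterS => V nVz; apply/nonunitsP; [exact: XV | right].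
Qed.

Definition itv_of (t : R) (tI : I t) : I := SigSub (mem_set tI).

Lemma itv_bounds (r : I) : a <= val r <= b.
Proof. by have := set_mem (valP r); rewrite /= in_itv. Qed.

(** The ring [mval_ring r] itself, as a member of the space. *)
Definition monomial_point (r : I) : X :=
  SigSub (mem_set (mval_ring_val_overring hD a0 (itv_bounds r))).

Lemma itv_pos (r : I) : 0 < val r.
Proof. by case/andP: (itv_bounds r) => /(lt_le_trans a0). Qed.

Lemma rank1_slopeX (W : X) (t : R) : 0 < t ->
  rank1_overrings (val W) (mval_ring x y t) -> slopeX W = t.
Proof.
move=> t0 /slopeX_rank1 e; apply/esym/(mval_ring_inj hD) => //.
by have := slopeX_itv W; rewrite /= in_itv /= => /andP[/(lt_le_trans a0)].
Qed.

Lemma slopeX_monomial_point (r : I) : slopeX (monomial_point r) = val r.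
Proof.
have r0 := itv_pos r; apply: rank1_slopeX => //; split=> //.
  exact: mval_ring_valuation_ring.
exact: mval_ring_krull_dim.
Qed.

Lemma same_rank1E (V W : X) : same_rank1 V W = (slopeX V == slopeX W).
Proof.
apply/asboolP/eqP => [e|e]; last first.
  by apply/seteqP; split=> U /slopeX_rank1 ->; apply/slopeX_rank1; rewrite e.
have : rank1_overrings (val W) (mval_ring x y (slopeX V)).
  by rewrite -e; apply/slopeX_rank1.
move=> /rank1_slopeX -> //.
by have := slopeX_itv V; rewrite /= in_itv /= => /andP[/(lt_le_trans a0)].
Qed.

Definition phi (W : X) : I := itv_of (slopeX_itv W).

Lemma phiP W (r : I) : phi W = r <-> rank1_overrings (val W) (mval_ring x y (val r)).
Proof.
split=> [<-|/rank1_slopeX e]; first exact/slopeX_rank1.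
by apply: val_inj; rewrite /= e// itv_pos.
Qed.

Lemma phi_zariski_continuous : continuous (phi : zariskiX -> I).
Proof.
apply/continuousP => _ [B oB <-].
have := iffLR (continuousP _) slopeX_continuous B oB.
by congr open; apply/seteqP; split=> W /=; rewrite set_valE.
Qed.

Lemma phi_patch_continuous : continuous (phi : patchX -> I).
Proof.
apply/continuousP => A oA; apply: patch_open_zariski.
exact: (iffLR (continuousP _) phi_zariski_continuous A oA).
Qed.

Lemma slopeX_patch_continuous : continuous (slopeX : patchX -> R).
Proof.
apply/continuousP => A oA; apply: patch_open_zariski.
exact: (iffLR (continuousP _) slopeX_continuous A oA).
Qed.

(** The complement of a saturated patch open set is compact, so its image in the
    real line is compact, hence closed. *)
Lemma monomial_point_open (A : set X) : open (A : set patchX) ->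
  (forall V W, slopeX V = slopeX W -> A V -> A W) ->
  open [set r : I | A (monomial_point r)].
Proof.
move=> oA satA.
have cptC : compact (slopeX @` (~` A)).
  apply: (@continuous_compact patchX R slopeX (~` A)).
    exact/continuous_subspaceT/slopeX_patch_continuous.
  apply: (@subclosed_compact patchX _ setT) => //; last exact: patchX_compact.
  exact: (@open_closedC patchX).
exists (~` (slopeX @` ~` A)).
  by apply: closed_openC; exact: compact_closed cptC.
apply/seteqP; split=> r /=.
  move=> nA; apply: contrapT => nAr; apply: nA.
  by exists (monomial_point r); rewrite ?slopeX_monomial_point.
by move=> Ar [W nAW e]; apply: nAW; apply: satA Ar; rewrite slopeX_monomial_point.
Qed.

Definition tphi (q : quotX x y a b) : I := phi (repr q).

Lemma pi_slopeX V W : slopeX V = slopeX W -> \pi_(quotX x y a b) V = \pi W.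
Proof. by move=> e; apply/eqmodP; rewrite /= same_rank1E e. Qed.

Lemma tphi_pi W : tphi (\pi W) = phi W.
Proof.
apply: val_inj => /=; apply/eqP; rewrite -same_rank1E.
by have /eqmodP := reprK (\pi_(quotX x y a b) W).
Qed.

Definition monomial_class (r : I) : quotX x y a b :=
  \pi_(quotX x y a b) (monomial_point r).

Lemma tphiK : cancel tphi monomial_class.
Proof.
elim/quotW => W; rewrite /monomial_class tphi_pi; apply: pi_slopeX.
exact: slopeX_monomial_point.
Qed.

Lemma monomial_classK : cancel monomial_class tphi.
Proof. by move=> r; rewrite tphi_pi; apply: val_inj; exact: slopeX_monomial_point. Qed.

Lemma monomial_class_patch_continuous :
  continuous (monomial_class : I -> patch_quotX x y a b).
Proof.
apply/continuousP => A oA; apply: (monomial_point_open oA) => V W e.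
by rewrite /preimage /= (pi_slopeX e).
Qed.

Lemma monomial_class_zariski_continuous :
  continuous (monomial_class : I -> zariski_quotX x y a b).
Proof.
apply/continuousP => A oA; apply: (monomial_point_open (patch_open_zariski oA)).
move=> V W e.
by rewrite /preimage /= (pi_slopeX e).
Qed.

Lemma tphi_patch_homeomorphism :
  homeomorphism (tphi : patch_quotX x y a b -> I).
Proof.
exists monomial_class; split.
- exact: tphiK.
- exact: monomial_classK.
- apply/quotient_continuous; rewrite (_ : _ \o _ = phi).
    exact: phi_patch_continuous.
  by apply/funext => W; exact: tphi_pi.
- exact: monomial_class_patch_continuous.
Qed.

Lemma tphi_zariski_homeomorphism :
  homeomorphism (tphi : zariski_quotX x y a b -> I).
Proof.
exists monomial_class; split.
- exact: tphiK.
- exact: monomial_classK.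
- apply/quotient_continuous; rewrite (_ : _ \o _ = phi).
    exact: phi_zariski_continuous.
  by apply/funext => W; exact: tphi_pi.
- exact: monomial_class_zariski_continuous.
Qed.

End SpaceOfOverrings.

Theorem mainTheorem7 (R : realType) (D : idomainType) (x y : D) (a b : R)
    (hD : regular_local_ring_with [:: x; y]) (ha : 0 < a) (hab : a < b) :
  exists phi : spaceX x y a b -> `[a, b]%classic,
    (forall W r, phi W = r <->
       rank1_overrings (val W) (mval_ring x y (val r))) /\
    exists tphi : quotX x y a b -> `[a, b]%classic,
      (forall W, tphi (\pi W) = phi W) /\
      homeomorphism (tphi : patch_quotX x y a b -> `[a, b]%classic) /\
      homeomorphism (tphi : zariski_quotX x y a b -> `[a, b]%classic).
Proof.
exists (phi hD ha); split; first exact: phiP.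
exists (tphi hD ha); split; first exact: tphi_pi.
by split; [exact: tphi_patch_homeomorphism | exact: tphi_zariski_homeomorphism].
Qed.
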